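(* For each $\varepsilon\in\{+1,-1\}$ there exists a (nonempty) family of rotationally invariant solutions $(A,\phi)$ of the Kapustin-Witten equations $$F_A-\phi\wedge\phi-\star d_A\phi=0,\qquad d_A^{\star}\phi=0$$ on Euclidean $\mathbb{R}^4$ with instanton number $\varepsilon$, such that each $(A,\phi)$ is smooth away from a sphere $\{|x|=r\}$, $r>0$, and at this sphere the real part $A$ is $C^1$ while the imaginary part $\phi$ is singular (it does not extend continuously across the sphere). The equations are understood to hold off the sphere.
   Context: $\mathbb{R}^4$ is identified with the quaternions $\mathbb{H}$, $x=x_1+x_2I+x_3J+x_4K$, oriented by $dx_1\wedge dx_2\wedge dx_3\wedge dx_4$; $\mathfrak{su}(2)$ is identified with the imaginary quaternions and $SU(2)$ with the unit quaternions. $A$ and $\phi$ are $\mathfrak{su}(2)$-valued 1-forms ($A$ a connection form on the trivial bundle); they are called the real and imaginary parts of the solution (of the complex connection $A+i\phi$). $F_A=dA+A\wedge A$, $d_A\phi=d\phi+A\wedge\phi+\phi\wedge A$, $\star$ is the Euclidean Hodge star, and $d_A^\star\phi=0$ means $d\star\phi+A\wedge\star\phi+\star\phi\wedge A=0$. A pair $(A,\phi)$ is rotationally invariant if for all unit quaternions $a,b$ its pullback under $x\mapsto axb$ is $SU(2)$-gauge equivalent to $(A,\phi)$ (one gauge transformation for both $A$ and $\phi$). The instanton number is $k=\frac{1}{4\pi^2}\int_{\mathbb{R}^4}\mathrm{tr}(F_A\wedge F_A)$ with $\mathrm{tr}(F_A\wedge F_A)=(|F_A^+|^2-|F_A^-|^2)\,dx_1\wedge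 dx_2\wedge dx_3\wedge dx_4$, where $F_A^\pm$ are the self-dual/anti-self-dual parts, $|I|=|J|=|K|=1$ and $|dx_i\wedge dx_j|=1$ for $i<j$ (orthonormal). *)

(* Defs.v *)
From HB Require Import structures.
From mathcomp Require Import all_boot all_order all_algebra.
From mathcomp Require Import all_classical all_reals all_analysis.

Set Implicit Arguments.
Unset Strict Implicit.
Unset Printing Implicit Defensive.

Import Order.TTheory GRing.Theory Num.Theory.
Import numFieldNormedType.Exports.

Local Open Scope ring_scope.

(* R^4 and the quaternions are the same type 'rV[R]_4: the row vector
   (x 0 0, x 0 1, x 0 2, x 0 3) is the quaternion
   x 0 0 + x 0 1 I + x 0 2 J + x 0 3 K. *)

Section Quaternions.
Context {R : realType}.
Implicit Types x y : 'rV[R]_4.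

Definition mkquat (a b c d : R) : 'rV[R]_4 := \row_(i < 4) [:: a; b; c; d]`_i.

Definition qmul x y : 'rV[R]_4 :=
  let: (x0, x1, x2, x3) := (x 0 0, x 0 1, x 0 2, x 0 3) in
  let: (y0, y1, y2, y3) := (y 0 0, y 0 1, y 0 2, y 0 3) in
  mkquat (x0 * y0 - x1 * y1 - x2 * y2 - x3 * y3)
         (x0 * y1 + x1 * y0 + x2 * y3 - x3 * y2)
         (x0 * y2 - x1 * y3 + x2 * y0 + x3 * y1)
         (x0 * y3 + x1 * y2 - x2 * y1 + x3 * y0).

Definition qconj x : 'rV[R]_4 := mkquat (x 0 0) (- x 0 1) (- x 0 2) (- x 0 3).

Definition qnormsq x : R := \sum_(i < 4) x 0 i ^+ 2.

(* The Euclidean norm. The library norm `|x| on 'rV[R]_4 is the sup norm; it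
   is used below only through the topology it induces. *)
Definition qnorm x : R := Num.sqrt (qnormsq x).

(* SU(2) *)
Definition qunit x : Prop := qnorm x = 1.

(* su(2) *)
Definition qimag x : Prop := x 0 0 = 0.

Definition sphere (r : R) : set 'rV[R]_4 := [set x | qnorm x = r]%classic.

End Quaternions.

Section Regularity.
Context {R : realType}.
Implicit Types (f : 'rV[R]_4 -> 'rV[R]_4) (Om : set 'rV[R]_4).

Definition pderiv (i : 'I_4) f : 'rV[R]_4 -> 'rV[R]_4 :=
  fun x => 'D_(delta_mx 0 i) f x.

(* f is of class C^k on the open set Om. *)
Fixpoint Ck (k : nat) Om f : Prop :=
  (forall x, Om x -> {for x, continuous f}) /\
  match k with
  | 0 => True
  | k'.+1 => forall i : 'I_4,
      (forall x, Om x -> derivable f x (delta_mx 0 i)) /\ Ck k' Om (pderiv i f)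
  end.

Definition smooth Om f : Prop := forall k, Ck k Om f.

End Regularity.

(* Quaternion-valued differential forms of mixed degree on R^4: the form
   \sum_S a_S dx_S is represented by S |-> a_S, where, for S = {i1 < ... < ik},
   dx_S = dx_i1 /\ ... /\ dx_ik. *)
Definition form (R : realType) := {set 'I_4} -> 'rV[R]_4 -> 'rV[R]_4.

(* Quaternion-valued 1-forms \sum_i a_i dx_i. *)
Definition oneform (R : realType) := 'I_4 -> 'rV[R]_4 -> 'rV[R]_4.

Section Forms.
Context {R : realType}.
Implicit Types (al be : form R) (a : oneform R).

Definition of1 a : form R := fun S x => \sum_(i < 4 | S == [set i]) a i x.

(* For disjoint T and U, dx_T /\ dx_U = dxsign T U * dx_(T :|: U). *)
Definition dxsign (T U : {set 'I_4}) : R :=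
  (- 1) ^+ #|[set p : 'I_4 * 'I_4 | [&& p.1 \in T, p.2 \in U & (p.2 < p.1)%N]]|.

Definition addform al be : form R := fun S x => al S x + be S x.

Definition subform al be : form R := fun S x => al S x - be S x.

Definition wedge al be : form R := fun S x =>
  \sum_(T : {set 'I_4} | T \subset S)
     dxsign T (S :\: T) *: qmul (al T x) (be (S :\: T) x).

(* d(a_T dx_T) = \sum_i (d_i a_T) dx_i /\ dx_T *)
Definition extd al : form R := fun S x =>
  \sum_(i < 4 | i \in S) dxsign [set i] (S :\ i) *: pderiv i (al (S :\ i)) x.

(* The Euclidean star for the orientation dx_1 /\ dx_2 /\ dx_3 /\ dx_4, under
   which star dx_T = dxsign T (~: T) * dx_(~: T). *)
Definition star al : form R := fun S x => dxsign (~: S) S *: al (~: S) x.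

(* Pullback of a 1-form by a map F. *)
Definition pullback1 (F : 'rV[R]_4 -> 'rV[R]_4) a : oneform R := fun i x =>
  \sum_(j < 4) pderiv i F x 0 j *: a j (F x).

End Forms.

Section KapustinWitten.
Context {R : realType}.
Implicit Types (A phi : oneform R) (u : 'rV[R]_4 -> 'rV[R]_4).
Implicit Types (Om : set 'rV[R]_4).

Definition su2_valued Om A : Prop := forall i x, Om x -> qimag (A i x).

Definition curvature A : form R :=
  addform (extd (of1 A)) (wedge (of1 A) (of1 A)).

(* d_A phi = d phi + A /\ phi + phi /\ A, for phi of odd degree. *)
Definition covd A (be : form R) : form R :=
  addform (extd be) (addform (wedge (of1 A) be) (wedge be (of1 A))).

Definition kw_solution Om A phi : Prop := forall (S : {set 'I_4}) x, Om x ->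
  subform (subform (curvature A) (wedge (of1 phi) (of1 phi)))
    (star (covd A (of1 phi))) S x = 0 /\
  covd A (star (of1 phi)) S x = 0.

(* Action of u : R^4 -> SU(2) on connection forms, u A u^-1 - du u^-1, and on
   sections of the adjoint bundle, u phi u^-1. *)
Definition gauge_conn u A : oneform R := fun i x =>
  qmul (qmul (u x) (A i x)) (qconj (u x)) - qmul (pderiv i u x) (qconj (u x)).

Definition gauge_adj u phi : oneform R := fun i x =>
  qmul (qmul (u x) (phi i x)) (qconj (u x)).

(* Om is meant to be invariant under the maps x |-> a x b. *)
Definition rot_invariant Om A phi : Prop :=
  forall a b : 'rV[R]_4, qunit a -> qunit b ->
  exists u, [/\ smooth setT u, forall x, qunit (u x) &
    forall i x, Om x ->
      pullback1 (fun y => qmul (qmul a y) b) A i x = gauge_conn u A i x /\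
      pullback1 (fun y => qmul (qmul a y) b) phi i x = gauge_adj u phi i x].

Definition sd_part (al : form R) : form R :=
  fun S x => 2^-1 *: (al S x + star al S x).

Definition asd_part (al : form R) : form R :=
  fun S x => 2^-1 *: (al S x - star al S x).

Definition form_normsq (al : form R) (x : 'rV[R]_4) : R :=
  \sum_(S : {set 'I_4}) qnormsq (al S x).

(* The coefficient of dx_1 /\ dx_2 /\ dx_3 /\ dx_4 in tr (F_A /\ F_A). *)
Definition trFF A (x : 'rV[R]_4) : R :=
  form_normsq (sd_part (curvature A)) x - form_normsq (asd_part (curvature A)) x.

(* Lebesgue measure on R^4, read as ((R * R) * R) * R. *)
Local Notation mu := (@lebesgue_measure R).
Local Notation mu4 := (((mu \x mu) \x mu) \x mu)%E.

Definition pt4 (p : R * R * R * R) : 'rV[R]_4 :=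
  mkquat p.1.1.1 p.1.1.2 p.1.2 p.2.

Definition has_instanton_number A (k : R) : Prop :=
  mu4.-integrable setT (fun p => (trFF A (pt4 p))%:E) /\
  (4 * pi ^+ 2)^-1 * Rintegral mu4 setT (fun p => trFF A (pt4 p)) = k.

Definition extends_continuously Om phi : Prop :=
  exists psi : oneform R,
    (forall i, continuous (psi i)) /\ (forall i x, Om x -> psi i x = phi i x).

End KapustinWitten.

(* Main.v *)
Require Import Defs.
From HB Require Import structures.
From mathcomp Require Import all_boot all_order all_algebra.
From mathcomp Require Import all_classical all_reals all_analysis.
From mathcomp Require Import measurable_realfun.
From mathcomp Require Import ring lra.

Set Implicit Arguments.
Unset Strict Implicit.
Unset Printing Implicit Defensive.

Import Order.TTheory GRing.Theory Num.Theory.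
Import numFieldNormedType.Exports.

Local Open Scope classical_set_scope.
Local Open Scope ring_scope.

(** Write x = r u with u a unit quaternion and put s = log r.  The ansatz
    A = a(s) w, phi = b(s) w, where w = Im (x dxbar) / r^2 = u dubar satisfies
    dw + w /\ w = 0, reduces the Kapustin-Witten equations to two ordinary
    differential equations: with h = 2 a - 1,
      h' = - 4 h b   and   b' = 2 b^2 + (1 - h^2) / 2,
    the third equation being automatic.  They have the first integral
    12 h b^2 - h^3 + 3 h = constant.  On its level - 2 the solution with
    h -> -1, b -> 0 at the origin (the condition for A and phi to be smooth
    there) is rational in t = r^2: up to scaling,
      h = - (t - 1)^2 / (t^2 + 4 t + 1),
      b = - 3 t (t + 1) / ((t - 1) (t^2 + 4 t + 1)).
    So h has a double zero and b a simple pole on the unit sphere.  The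
    equations are invariant under h |-> - h, hence changing the sign of h
    outside the unit ball gives another solution off the sphere, and because the
    zero is double the pasted h is C^1.  It now runs from -1 to 1, that is, a
    runs from 0 to 1, and only this pasted solution carries instanton number:
    tr (F_A /\ F_A) is a positive multiple of a' (a - a^2), so that its integral
    is that of a polynomial in a from 0 to 1.

    Reversing the orientation of R^4 exchanges x dxbar with xbar dx and
    preserves the equations once phi is replaced by - phi; this gives the
    instanton number -1.  Both signs eps are treated together: the form
    [mc_form eps] is Im (x dxbar) or Im (xbar dx), and the solution is
    A = f(|x|^2) mc_form, phi = eps g(|x|^2) mc_form with a = t f, b = t g.

    The ansatz makes rotational invariance a computation with quaternions:
    under x |-> a x b the form Im (x dxbar) is conjugated by the constant a
    ([mc_form_rotate]).  The equations hold because each coordinate of their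
    defect is a combination of the two differential equations
    ([kw_defect01] and its five companions).  For the instanton number, the
    push-forward of the Lebesgue measure of R^2 by the squared norm is pi times
    that of the half-line ([pushforward_sqnorm2]); applied to the two
    coordinate planes of R^4 it gives
    int h(|x|^2) dx = pi^2 int_0^oo s h(s) ds ([integral_sqnorm4]), and
    s h(s) has the primitive 12 a^2 - 8 a^3 ([integral_charge_density]). *)

(** * Integrals of radial functions on R^2 and R^4 *)

Section RadialIntegrals.
Context {R : realType}.
Local Notation mu := (@lebesgue_measure R).
Local Notation mu2 := (mu \x mu)%E.

Lemma derivable_LRcontinuous (F : R -> R) (a b : R) :
  (forall x, derivable F x 1) -> derivable_oo_LRcontinuous F a b.
Proof.
move=> dF.
have cF : continuous F.
  by move=> x; apply: differentiable_continuous; apply/derivable1_diffP.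
split; first by move=> x _.
- by apply: cvg_at_right_filter; exact: cF.
- by apply: cvg_at_left_filter; exact: cF.
Qed.

(** Area of the disc of radius r, sliced vertically; the substitution
    x = r sin theta turns the integrand into 2 (r cos theta)^2. *)
Lemma integral_half_disc (r : R) : 0 < r ->
  (\int[mu]_(x in `[(- r)%R, r]) (2 * Num.sqrt (r ^+ 2 - x ^+ 2))%:E =
   (pi * r ^+ 2)%:E)%E.
Proof.
move=> r0.
have pi0 : 0 < pi / 2 :> R by rewrite divr_gt0// pi_gt0.
pose F (x : R) := r * sin x.
have dF (x : R) : is_derive x 1 F (r * cos x).
  by apply: is_derive_eq; rewrite /GRing.scale/= ?mulr1 ?mul0r ?addr0.
have F'E : (derive1 F) = (fun x => r * cos x).
  by apply/funext => x; rewrite derive1E derive_val.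
have cF'  : continuous (derive1 F).
  by rewrite F'E => x; apply: cvgM; [exact: cvg_cst|exact: continuous_cos].
have Fr : F (pi / 2) = r by rewrite /F sin_pihalf mulr1.
have FNr : F (- (pi / 2)) = - r by rewrite /F sinN sin_pihalf mulrN1.
have ab : - (pi / 2) <= pi / 2 :> R by rewrite ge0_cp// ltW.
pose G (x : R) := 2 * Num.sqrt (r ^+ 2 - x ^+ 2).
transitivity (\int[mu]_(x in `[(F (- (pi / 2)))%R, (F (pi / 2))%R]) (G x)%:E)%E.
  by rewrite Fr FNr.
have cG : continuous G.
  move=> x; apply: cvgM; first exact: cvg_cst.
  apply: continuous_comp; last exact: sqrt_continuous.
  by apply: cvgB; [exact: cvg_cst|exact: exprn_continuous].
rewrite integration_by_substitution_increasing//; last 5 first.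
- by move=> x y xI yI xy; rewrite ltr_pM2l// ltr_sin.
- by apply/cvg_ex; exists ((derive1 F) (- (pi / 2))); apply: cvg_at_right_filter;
  exact: cF'.
- by apply/cvg_ex; exists ((derive1 F) (pi / 2)); apply: cvg_at_left_filter; exact: cF'.
- by apply: derivable_LRcontinuous => x; case: (dF x).
- exact: continuous_subspaceT.
(* a primitive of 2 (r cos x)^2 *)
pose H (x : R) := r ^+ 2 * (x + sin x * cos x).
have dH (x : R) : is_derive x 1 H (2 * (r * cos x) ^+ 2).
  apply: is_derive_eq.
  rewrite /GRing.scale/= mulrN -!expr2 (sin2cos2 x); ring.
transitivity (\int[mu]_(x in `[(- (pi / 2))%R, (pi / 2)%R]) (2 *
  (r * cos x) ^+ 2)%:E)%E.
  apply: eq_integral => x /[!inE] /=; rewrite in_itv/= => xI.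
  rewrite F'E /G /F /=; congr (_%:E); rewrite ?fctE.
  have -> : r ^+ 2 - (r * sin x) ^+ 2 = (r * cos x) ^+ 2.
    by rewrite !exprMn cos2sin2; ring.
  rewrite sqrtr_sqr ger0_norm; first by ring.
  by rewrite mulr_ge0 ?cos_ge0_pihalf// ltW.
rewrite (@continuous_FTC2 _ _ H).
- rewrite /H sinN cosN sin_pihalf cos_pihalf -EFinB; congr (_%:E); field; lra.
- lra.
- apply: continuous_subspaceT => x.
  apply: cvgM; [exact: cvg_cst|].
  by apply: cvgM; (apply: cvgM; [exact: cvg_cst|exact: continuous_cos]).
- by apply: derivable_LRcontinuous => x; case: (dH x).
- by move=> x _; rewrite derive1E derive_val.
Qed.

(** The formula holds for every x: outside the disc the square root of a
    negative number is 0. *)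
Lemma lebesgue_measure_xsection_disc (c x : R) :
  mu (xsection [set p : R * R | p.1 ^+ 2 + p.2 ^+ 2 < c] x) =
  (2 * Num.sqrt (c - x ^+ 2))%:E.
Proof.
have [cx|cx] := ltP 0 (c - x ^+ 2).
  set s := Num.sqrt _.
  have s0 : 0 < s by rewrite sqrtr_gt0.
  have -> : xsection [set p : R * R | p.1 ^+ 2 + p.2 ^+ 2 < c] x = `](- s), s[%classic.
    apply/seteqP; split=> y; rewrite /xsection/= inE/= in_itv/= -ltr_norml.
      by move=> xy; rewrite -sqrtr_sqr ltr_sqrt// ltrBrDl.
    by rewrite -sqrtr_sqr ltr_sqrt// ltrBrDl.
  by rewrite lebesgue_measure_itv/= lte_fin gtrN// -EFinB; congr (_%:E); ring.
have -> : xsection [set p : R * R | p.1 ^+ 2 + p.2 ^+ 2 < c] x = set0.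
  apply/seteqP; split=> // y; rewrite /xsection/= inE/= => xy.
  by have := sqr_ge0 y; lra.
by rewrite measure0 ler0_sqrtr// mulr0.
Qed.

Lemma disc_area (c : R) :
  mu2 [set p : R * R | p.1 ^+ 2 + p.2 ^+ 2 < c] = (pi * Num.max c 0)%:E.
Proof.
transitivity (\int[mu]_x (2 * Num.sqrt (c - x ^+ 2))%:E)%E.
  by apply: eq_integral => x _ /=; rewrite lebesgue_measure_xsection_disc.
have [c0|c0] := leP c 0.
  rewrite mulr0 integral0_eq// => x _; rewrite ler0_sqrtr ?mulr0//.
  by have := sqr_ge0 x; lra.
have r0 : 0 < Num.sqrt c by rewrite sqrtr_gt0.
have cE : c = Num.sqrt c ^+ 2 by rewrite sqr_sqrtr// ltW.
rewrite {2}cE -(integral_half_disc r0) -cE [RHS]integral_mkcond.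
apply: eq_integral => x _; rewrite patchE; case: ifPn => // /negP xI.
rewrite ler0_sqrtr ?mulr0// leNgt; apply/negP => cx; apply: xI.
rewrite inE/= in_itv/= -ler_norml -sqrtr_sqr ler_sqrt; last exact: ltW.
lra.
Qed.

Let sqnorm2 (p : R * R) : measurableTypeR R := p.1 ^+ 2 + p.2 ^+ 2.

Let measurable_sqnorm2 : measurable_fun setT sqnorm2.
Proof.
by apply: measurable_funD; apply: measurable_funX;
  [exact: measurable_fst|exact: measurable_snd].
Qed.

(** Both measures give pi c to the half-line of the reals < c (for c > 0, this is
    the area of a disc), and half-lines form a pi-system generating the Borel
    sets. *)
Lemma pushforward_sqnorm2 (A : set (measurableTypeR R)) : measurable A ->
  pushforward mu2 sqnorm2 A =
  mscale (NngNum (pi_ge0 R)) (mrestr mu (measurable_itv `[0%R, +oo[)) A.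
Proof.
move=> mA.
pose nu1 : {measure set (measurableTypeR R) -> \bar R} :=
  ltac:(unshelve refine [the {measure set (measurableTypeR R) -> \bar R} of
    pushforward mu2 sqnorm2]; exact: measurable_sqnorm2).
pose nu2 := [the {measure set (measurableTypeR R) -> \bar R} of
  mscale (NngNum (pi_ge0 R)) (mrestr mu (measurable_itv `[0%R, +oo[))].
have nu1E (c : R) : nu1 `]-oo, c[%classic = (pi * Num.max c 0)%:E.
  rewrite -disc_area /nu1/= /pushforward; congr (mu2 _).
apply: (measure_unique (T := measurableTypeR R) (@RGenInftyO.G R)
  (fun n => `]-oo, n%:R[%classic) _ _ _ _ nu1 nu2) => //.
- exact: RGenInftyO.measurableE.
- move=> _ _ [x ->] [y ->]; exists (Num.min x y).
  by apply/seteqP; split=> z /=; rewrite !in_itv/= lt_min; [case=> -> ->|case/andP].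
- by move=> n; exists n%:R.
- apply/seteqP; split=> // x _; exists (Num.truncn x).+1 => //=.
  by rewrite in_itv/= truncnS_gt.
- move=> _ [c ->]; rewrite nu1E /nu2/= /mscale/= /mrestr.
  have -> : `]-oo, c[%classic `&` `[0, +oo[%classic = `[0, c[%classic.
    apply/seteqP; split=> x /=; rewrite !in_itv/= andbT; first by case=> -> ->.
    by case/andP=> -> ->.
  rewrite lebesgue_measure_itv/= lte_fin EFinM; congr (_ * _)%E.
  by case: ltP => c0; rewrite ?oppr0 ?adde0 ?subr0; case: (ltP 0 c) => //; lra.
- by move=> n; rewrite nu1E ltry.
Qed.

Lemma integral_sqnorm2 (h : R -> \bar R) :
  measurable_fun [set: measurableTypeR R] h -> (forall s, (0 <= h s)%E) ->
  (\int[mu2]_p h (p.1 ^+ 2 + p.2 ^+ 2)%R = pi%:E * \int[mu]_(s in `[0%R, +oo[) h s)%E.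
Proof.
move=> mh h0.
have sq0 : sqnorm2 @^-1` `[0, +oo[ = setT.
  by apply/seteqP; split=> // p _; rewrite /= in_itv/= andbT addr_ge0 ?sqr_ge0.
transitivity (\int[pushforward mu2 sqnorm2]_(s in `[0%R, +oo[) h s)%E.
  by rewrite ge0_integral_pushforward ?sq0//; exact: measurable_funTS.
transitivity (\int[mscale (NngNum (pi_ge0 R)) mu]_(s in `[0%R, +oo[) h s)%E.
  apply: eq_measure_integral => A mA A0.
  transitivity (pi%:E * mu (A `&` `[0%R, +oo[))%E; first exact: pushforward_sqnorm2.
  by rewrite setIidl.
by rewrite ge0_integral_mscale//; exact: measurable_funTS.
Qed.

Lemma lebesgue_measure_shift (c : R) (A : set (measurableTypeR R)) :
  measurable A -> pushforward mu (fun s : R => (c + s)%R : measurableTypeR R) A = mu A.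
Proof.
have mshift : measurable_fun setT (fun s : R => (c + s)%R : measurableTypeR R).
  by apply: measurable_funD; [exact: measurable_cst|exact: measurable_id].
move=> mA; apply/esym; move: A mA.
pose nu : {measure set (measurableTypeR R) -> \bar R} :=
  ltac:(unshelve refine [the {measure set (measurableTypeR R) -> \bar R} of
    pushforward mu (fun s : R => (c + s)%R : measurableTypeR R)]; exact: mshift).
apply: (@lebesgue_measure_unique _ nu) => _ [[a b] _ <-].
have -> : nu `]a, b]%classic = mu `]a - c, b - c]%classic.
  congr (mu _); apply/seteqP; split=> s /=; rewrite !in_itv/=; lra.
by rewrite !lebesgue_measure_itv/= !lte_fin ltrD2r -!EFinB; case: ifP => // _;
  congr (_%:E); ring.
Qed.

Lemma integral_shift (h : R -> \bar R) (c : R) :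
  measurable_fun [set: measurableTypeR R] h -> (forall s, (0 <= h s)%E) ->
  (\int[mu]_(s in `[0%R, +oo[) h (c + s)%R = \int[mu]_(s in `[c, +oo[) h s)%E.
Proof.
move=> mh h0.
have mshift : measurable_fun setT (fun s : R => (c + s)%R : measurableTypeR R).
  by apply: measurable_funD; [exact: measurable_cst|exact: measurable_id].
transitivity (\int[pushforward mu (fun s : R =>
  (c + s)%R : measurableTypeR R)]_(s in `[c, +oo[) h s)%E.
  rewrite ge0_integral_pushforward//; last exact: measurable_funTS.
  by congr (integral _ _ _); apply/seteqP; split=> s /=; rewrite !in_itv/= !andbT; lra.
by apply: eq_measure_integral => A mA _; exact: lebesgue_measure_shift.
Qed.

(** The left-hand side is the integral of h(s) over 0 <= c <= s, and for fixed s
    the variable c runs over an interval of length s. *)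
Lemma integral_sum_nonneg (h : R -> \bar R) :
  measurable_fun [set: measurableTypeR R] h -> (forall s, (0 <= h s)%E) ->
  (\int[mu]_(c in `[0%R, +oo[) \int[mu]_(s in `[0%R, +oo[) h (c + s)%R =
   \int[mu]_(s in `[0%R, +oo[) (s%:E * h s))%E.
Proof.
move=> mh h0.
pose T : set (measurableTypeR R * measurableTypeR R) := [set p | 0 <= p.1 <= p.2].
have mT : measurable T.
  rewrite (_ : T = (setT `&` [set p | cst 0 p <= p.1]) `&` (setT `&` [set p | p.1 <=
    p.2])).
    by apply: measurableI; apply: measurable_fun_le.
  by rewrite !setTI; apply/seteqP; split=> p /=; rewrite /T/=; [case/andP|case=> -> ->].
pose k (p : measurableTypeR R * measurableTypeR R) : \bar R := (h p.2 * (\1_T p)%:E)%E.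
have k0 p : (0 <= k p)%E by rewrite mule_ge0// lee_fin.
have mk : measurable_fun setT k.
  apply: emeasurable_funM; first exact: measurableT_comp mh measurable_snd.
  by apply/measurable_EFinP; exact: measurable_indic.
transitivity (\int[mu]_c \int[mu]_s k (c, s))%E.
  rewrite integral_mkcond; apply: eq_integral => c _; rewrite patchE.
  case: ifPn => [/set_mem|/negP cI].
    rewrite /= in_itv/= andbT => c0.
    rewrite integral_shift// integral_mkcond; apply: eq_integral => s _.
    rewrite patchE /k indicE/=; case: ifPn => [/set_mem|/negP sI].
      rewrite /= in_itv/= andbT => cs.
      by rewrite mem_set ?mule1//; apply/andP.
    rewrite memNset ?mule0// => /andP[_ cs]; apply: sI.
    by rewrite inE/= in_itv/= andbT.
  rewrite integral0_eq// => s _.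
  rewrite /k indicE memNset ?mule0// => /andP[c0 _]; apply: cI.
  by rewrite inE/= in_itv/= andbT.
rewrite fubini_tonelli//.
rewrite [RHS]integral_mkcond; apply: eq_integral => s _.
transitivity (h s * \int[mu]_c (\1_`[0%R, s] c)%:E)%E.
  rewrite -ge0_integralZl//.
  by apply/measurable_EFinP; exact: measurable_indic.
rewrite integral_indic// setIT/= lebesgue_measure_itv/= patchE lte_fin sube0 muleC.
case: ltP => s0.
  by rewrite mem_set//= in_itv/= andbT ltW.
rewrite mul0e; case: ifPn => // /set_mem; rewrite /= in_itv/= andbT => s0'.
by rewrite (_ : s = 0) ?mul0e//; apply: le_anti; rewrite s0 s0'.
Qed.

End RadialIntegrals.

Section SigmaFiniteProduct.
Context d1 d2 (T1 : measurableType d1) (T2 : measurableType d2) (R : realType).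
Context (m1 : {sigma_finite_measure set T1 -> \bar R}).
Context (m2 : {sigma_finite_measure set T2 -> \bar R}).

Let prod_sigma_finite : sigma_finite setT (m1 \x m2)%E.
Proof.
have /sigma_finiteP[F [FT ndF Foo]] := sigma_finiteT m1.
have /sigma_finiteP[G [GT ndG Goo]] := sigma_finiteT m2.
exists (fun n => F n `*` G n) => [|n]; last first.
  have [[mF ?] [mG ?]] := (Foo n, Goo n).
  by split; [exact: measurableX|rewrite product_measure1E// lte_mul_pinfty//
    ge0_fin_numE].
apply/esym/seteqP; split=> // -[x y] _.
have [i _ Fx] : (\bigcup_i F i) x by rewrite -FT.
have [j _ Gy] : (\bigcup_j G j) y by rewrite -GT.
exists (maxn i j) => //; split=> /=.
- by apply: (subsetPset _ _ (ndF _ _ (leq_maxl i j))).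
- by apply: (subsetPset _ _ (ndG _ _ (leq_maxr i j))).
Qed.

(** Bundles the product as a sigma-finite measure, which is what allows Tonelli's
    theorem to be iterated. *)
Definition sigma_finite_prod : {sigma_finite_measure set (T1 * T2)%type -> \bar R} :=
  HB.pack (m1 \x m2)%E (Measure_isSigmaFinite.Build _ _ _ (m1 \x m2)%E
    prod_sigma_finite).

End SigmaFiniteProduct.

(** Tonelli twice on the left, once on each inner integral on the right. *)
Lemma integral_product4 d (T : measurableType d) (R : realType)
    (m : {sigma_finite_measure set T -> \bar R}) (f : T * T * T * T -> \bar R) :
  measurable_fun setT f -> (forall p, (0 <= f p)%E) ->
  (\int[((m \x m) \x m) \x m]_p f p =
   \int[m \x m]_p \int[m \x m]_q f (p.1, p.2, q.1, q.2))%E.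
Proof.
move=> mf f0.
pose m2 := sigma_finite_prod m m; pose m3 := sigma_finite_prod m2 m.
pose F (p : T * T * T) := (\int[m]_w f (p, w))%E.
have mF : measurable_fun setT F by exact: (measurable_fun_fubini_tonelli_F f).
have F0 p : (0 <= F p)%E by apply: integral_ge0.
apply: (eq_trans (@fubini_tonelli1 _ _ _ _ R m3 m f mf f0)).
apply: (eq_trans (@fubini_tonelli1 _ _ _ _ R m2 m F mF F0)).
apply: eq_integral => -[x y] _.
apply/esym.
pose g (q : T * T) := f (x, y, q.1, q.2).
have mg : measurable_fun setT g.
  apply: (measurableT_comp mf).
  apply: measurable_fun_pair; last exact: measurable_snd.
  apply: measurable_fun_pair; last exact: measurable_fst.
  exact: measurable_cst.
exact: (@fubini_tonelli1 _ _ T T R m m g mg (fun q => f0 _)).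
Qed.

Section RadialIntegrals4.
Context {R : realType}.
Local Notation mu := (@lebesgue_measure R).
Local Notation mu2 := (mu \x mu)%E.
Local Notation T := (measurableTypeR R).

Lemma measurable_sqnorm4 : measurable_fun setT
  (fun p : T * T * T * T => p.1.1.1 ^+ 2 + p.1.1.2 ^+ 2 + p.1.2 ^+ 2 + p.2 ^+ 2 : T).
Proof.
have mfst1 : measurable_fun setT (fun p : T * T * T * T => p.1.1).
  by apply: measurableT_comp; [exact: measurable_fst|exact: measurable_fst].
by apply: measurable_funD; [apply: measurable_funD; [apply: measurable_funD|]|];
  apply: measurable_funX; (exact: measurable_snd ||
  (apply: measurableT_comp; [exact: measurable_fst|exact: mfst1]) ||
  (apply: measurableT_comp; [exact: measurable_snd|exact: mfst1]) ||
  (apply: measurableT_comp; [exact: measurable_snd|exact: measurable_fst])).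
Qed.

(** Polar coordinates in two orthogonal planes: the squared norms c and s of the
    two components contribute pi dc and pi ds, and int int h(c + s) dc ds is the
    integral of s h(s). *)
Lemma integral_sqnorm4 (h : R -> \bar R) :
  measurable_fun [set: T] h -> (forall s, (0 <= h s)%E) ->
  (\int[((mu \x mu) \x mu) \x mu]_p
     h (p.1.1.1 ^+ 2 + p.1.1.2 ^+ 2 + p.1.2 ^+ 2 + p.2 ^+ 2)%R =
   (pi ^+ 2)%:E * \int[mu]_(s in `[0%R, +oo[) (s%:E * h s))%E.
Proof.
move=> mh h0.
rewrite (@integral_product4 _ T R mu (fun p =>
  h (p.1.1.1 ^+ 2 + p.1.1.2 ^+ 2 + p.1.2 ^+ 2 + p.2 ^+ 2))); last 2 first.
- by apply: (measurableT_comp mh); exact: measurable_sqnorm4.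
- by move=> p.
have mhc c : measurable_fun [set: T] (fun s : T => h (c + s)).
  apply: (measurableT_comp mh).
  by apply: measurable_funD; [exact: measurable_cst|exact: measurable_id].
pose K c := (\int[mu]_(s in `[0%R, +oo[) h (c + s)%R)%E.
transitivity (\int[mu2]_p (pi%:E * K (p.1 ^+ 2 + p.2 ^+ 2)%R))%E.
  apply: eq_integral => p _; rewrite -(integral_sqnorm2 (mhc _))//.
  by apply: eq_integral => q _; rewrite addrA.
have mK : measurable_fun [set: T] K.
  pose k (p : T * T) := ((fun s => h (p.1 + s)) \_ `[0, +oo[) p.2.
  have mhk : measurable_fun setT (fun p : T * T => h (p.1 + p.2)).
    apply: (measurableT_comp mh).
    by apply: measurable_funD; [exact: measurable_fst|exact: measurable_snd].
  rewrite (_ : K = fubini_F mu k); last first.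
    by apply/funext => c; rewrite /K integral_mkcond.
  apply: measurable_fun_fubini_tonelli_F.
    rewrite (_ : k = (fun p : T * T => h (p.1 + p.2)) \_ (snd @^-1` `[0, +oo[));
      last first.
      by apply/funext => p; rewrite /k !patchE.
    have mS : measurable ((@snd T T) @^-1` `[0, +oo[).
      have := @measurable_snd _ _ T T measurableT _ (measurable_itv `[0, +oo[).
      by rewrite setTI.
    apply: (iffLR (measurable_restrictT _ mS)).
    by apply: measurable_funTS; exact: mhk.
  by move=> p; apply: erestrict_ge0.
have K0 c : (0 <= K c)%E by exact: integral_ge0.
rewrite (@integral_sqnorm2 _ (fun c => pi%:E * K c)%E); last 2 first.
- by apply: emeasurable_funM => //; exact: measurable_cst.
- by move=> c; rewrite mule_ge0// lee_fin pi_ge0.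
rewrite ge0_integralZl//; last 2 first.
- exact: measurable_funTS.
- by rewrite lee_fin pi_ge0.
by rewrite muleA expr2 EFinM integral_sum_nonneg.
Qed.

End RadialIntegrals4.

(** * A calculus of C^k functions *)

Section ScalarRegularity.
Context {R : realType}.
Local Notation V := 'rV[R]_4.
Implicit Types (f g : V -> R) (Om : set V).

(** Scalar analogue of [Ck]; the partial derivatives are existentially quantified so
    that closure under products and inverses is a direct induction on k. *)
Fixpoint scalarCk (k : nat) Om f : Prop :=
  (forall x, Om x -> {for x, continuous f}) /\
  match k with
  | 0 => True
  | k'.+1 => forall i : 'I_4, exists g,
      (forall x, Om x -> is_derive x (delta_mx 0 i : V) f (g x)) /\ scalarCk k' Om g
  end.

Lemma scalarCk_continuous k Om f x :
  scalarCk k Om f -> Om x -> {for x, continuous f}.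
Proof. by case: k => [|k] [cf _]; exact: cf. Qed.

Lemma scalarCk_pred k Om f : scalarCk k.+1 Om f -> scalarCk k Om f.
Proof.
elim: k f => [|k IH] f [cf df]; first by split.
by split=> // i; have [g [dg /IH gk]] := df i; exists g.
Qed.

(** Handles functions defined by different formulas on different components of
    an open set. *)
Lemma scalarCk_locally_constant k Om f :
  (forall x, Om x -> \forall y \near x, f y = f x) -> scalarCk k Om f.
Proof.
elim: k f => [|k IH] f fl; (split; first by
  move=> x /fl fx; exact: (cvg_near_cst (f x) fx)) => //.
move=> i; exists (fun=> 0); split.
  move=> x /fl fx; apply: (@near_eq_is_derive _ _ _ (cst (f x))).
    by apply: filterS fx.
by apply: IH => x _; near=> y.
Unshelve. all: by end_near. Qed.

Lemma scalarCk_cst k Om (c : R) : scalarCk k Om (fun=> c).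
Proof. by apply: scalarCk_locally_constant  => x _; near=> y.
Unshelve. all: by end_near. Qed.

Lemma is_derive_coord (j : 'I_4) (x v : V) : is_derive x v (fun y : V => y 0 j) (v 0 j).
Proof.
have dx : derivable (@id V) x v by exact: derivable_id.
apply: DeriveDef; first by move/derivable_mxP: dx; exact.
have := derive_mx dx; rewrite derive_id => /matrixP/(_ 0 j).
by rewrite mxE.
Qed.

Lemma scalarCk_coord k Om (j : 'I_4) : scalarCk k Om (fun x => x 0 j).
Proof.
case: k => [|k]; (split; first by move=> x _; exact: coord_continuous) => //.
move=> i; exists (fun=> (delta_mx 0 i : V) 0 j); split; last exact: scalarCk_cst.
by move=> x _; exact: is_derive_coord.
Qed.

Lemma scalarCkD k Om f g :
  scalarCk k Om f -> scalarCk k Om g -> scalarCk k Om (fun x => f x + g x).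
Proof.
elim: k f g => [|k IH] f g [cf df] [cg dg]; (split; first by
  move=> x xOm; apply: continuousD; [exact: cf|exact: cg]) => //.
move=> i; have [[f' [f'E f'k]] [g' [g'E g'k]]] := (df i, dg i).
exists (fun x => f' x + g' x); split; last exact: IH.
by move=> x xOm; apply: is_deriveD; [exact: f'E|exact: g'E].
Qed.

Lemma scalarCkM k Om f g :
  scalarCk k Om f -> scalarCk k Om g -> scalarCk k Om (fun x => f x * g x).
Proof.
elim: k f g => [|k IH] f g fk gk; have [cf df] := fk; have [cg dg] := gk;
  (split; first by move=> x xOm; apply: continuousM; [exact: cf|exact: cg]) => //.
move=> i; have [[f' [f'E f'k]] [g' [g'E g'k]]] := (df i, dg i).
exists (fun x => f x * g' x + g x * f' x); split.
  by move=> x xOm; apply: is_deriveM; [exact: f'E|exact: g'E].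
by apply: scalarCkD; apply: IH => //; exact: scalarCk_pred.
Qed.

Lemma scalarCkV k Om f : (forall x, Om x -> f x != 0) ->
  scalarCk k Om f -> scalarCk k Om (fun x => (f x)^-1).
Proof.
move=> f0; elim: k => [|k IH] fk; have [cf df] := fk;
  (split; first by move=> x xOm; apply: continuousV; [exact: f0|exact: cf]) => //.
move=> i; have [f' [f'E f'k]] := df i.
have Vk := IH (scalarCk_pred fk).
exists (fun x => (-1) * ((f x)^-1 * (f x)^-1) * f' x); split.
  move=> x xOm; have [fx f'x] := f'E x xOm.
  apply: DeriveDef; first by apply: derivableV => //; exact: f0.
  by rewrite deriveV ?f0// f'x mulN1r -invfM -expr2.
by do 2 apply: scalarCkM => //; [exact: scalarCk_cst|exact: scalarCkM].
Qed.

Lemma continuous_row (T : topologicalType) (F : T -> V) x :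
  (forall j, {for x, continuous (fun y => F y 0 j)}) -> {for x, continuous F}.
Proof.
move=> cF; apply/(@cvgrPdist_le _ _ _ (nbhs x) (nbhs_filter x)) => /= e e0.
have near_e : \forall y \near nbhs x, forall j, `|F x 0 j - F y 0 j| <= e.
  by apply: (@filter_forall _ _ _ (nbhs x) (nbhs_filter x)) => j;
    exact: ((cvgrPdist_le _ _).1 (cF j)).
apply: filterS near_e => y ye.
rewrite /Num.Def.normr/= mx_normrE (bigmax_le _ (ltW e0))//= => -[i j] _.
by rewrite !mxE/= ord1.
Qed.

Lemma is_derive_row (F : V -> V) (dF : V) x v :
  (forall j, is_derive x v (fun y => F y 0 j) (dF 0 j)) -> is_derive x v F dF.
Proof.
move=> H.
have Fx : derivable F x v by apply/derivable_mxP => i j; rewrite ord1; case: (H j).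
apply: DeriveDef => //; rewrite derive_mx//; apply/rowP => j; rewrite mxE.
by have [_ <-] := H j.
Qed.

(** The coordinates of F are only prescribed on Om; openness makes this enough for
    the derivatives. *)
Lemma Ck_of_coords k Om (F : V -> V) (f : 'I_4 -> V -> R) : open Om ->
  (forall j x, Om x -> F x 0 j = f j x) -> (forall j, scalarCk k Om (f j)) ->
  Ck k Om F.
Proof.
move=> oOm; move: k F f.
have near_eq (F : V -> V) (f : 'I_4 -> V -> R) j x :
    (forall j x, Om x -> F x 0 j = f j x) -> Om x -> \near x, f j x = F x 0 j.
  move=> Ff xOm; have := open_nbhs_nbhs (conj oOm xOm).
  by apply: filterS => y /(Ff j).
have cont k (F : V -> V) (f : 'I_4 -> V -> R) x :
    (forall j x, Om x -> F x 0 j = f j x) -> (forall j, scalarCk k Om (f j)) ->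
    Om x -> {for x, continuous F}.
  move=> Ff fk xOm; apply: continuous_row => j.
  have := scalarCk_continuous (fk j) xOm.
  rewrite /prop_for /continuous_at Ff//; apply: cvg_trans.
  exact: (@near_eq_cvg _ _ (nbhs x) (nbhs_filter x) _ _ (near_eq F f j x Ff xOm)).
elim=> [|k IH] F f Ff fk; (split; first by
  move=> x xOm; exact: (cont _ F f x Ff fk xOm)) => //.
move=> i.
have /choice[f' f'E] : forall j, exists g, (forall x, Om x ->
   is_derive x (delta_mx 0 i : V) (f j) (g x)) /\ scalarCk k Om g.
  by move=> j; have [_ /(_ i)] := fk j.
have dF x : Om x -> is_derive x (delta_mx 0 i : V) F (\row_j f' j x).
  move=> xOm; apply: is_derive_row => j; rewrite mxE.
  by apply: near_eq_is_derive (near_eq _ _ j x Ff xOm) _; have [+ _] := f'E j; exact.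
split; first by move=> x /dF[].
apply: (IH _ f') => [j x xOm|j]; last by have [] := f'E j.
by rewrite /pderiv; have [_ ->] := dF x xOm; rewrite mxE.
Qed.

End ScalarRegularity.

(** * The radial profiles and their differential equations *)

Section RadialProfile.
Context {R : realType}.
Local Notation V := 'rV[R]_4.
Implicit Types (t : R) (x : V).

(** A function that differs from an affine one by a quadratic error is
    differentiable; this covers the pasting point t = 1 without case distinction. *)
Lemma is_derive1_quadratic_bound (F : R -> R) t d :
  (forall h, `|F (t + h) - F t - d * h| <= h ^+ 2) -> is_derive t 1 F d.
Proof.
move=> Fd.
have cv : h^-1 *: ((F \o shift t) (h *: 1) - F t) @[h --> 0^'] --> d.
  apply/cvgrPdist_le => /= e e0; near=> h.
  have h0 : h != 0 by near: h; exact: nbhs_dnbhs_neq.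
  have he : `|h| <= e by near: h; exact: dnbhs0_le.
  apply: le_trans he.
  have -> : d - h^-1 *: ((F \o shift t) (h *: 1) - F t) =
      - h^-1 * (F (t + h) - F t - d * h).
    by rewrite /GRing.scale/= mulr1 (addrC h); field.
  by rewrite normrM normrN normfV ler_pdivrMl ?normr_gt0// -expr2 real_normK ?num_real.
by apply: DeriveDef; [apply/cvg_ex; exists d|apply/cvg_lim].
Unshelve. all: by end_near. Qed.

Definition excess_sq t : R := Num.max (t - 1) 0 ^+ 2.
Definition dexcess_sq t : R := 2 * Num.max (t - 1) 0.

Lemma excess_sq_le1 t : t <= 1 -> excess_sq t = 0 /\ dexcess_sq t = 0.
Proof. by move=> t1; rewrite /excess_sq /dexcess_sq max_r ?subr_le0// expr0n mulr0. Qed.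

Lemma excess_sq_ge1 t : 1 <= t -> excess_sq t = (t - 1) ^+ 2 /\ dexcess_sq t = 2 *
  (t - 1).
Proof. by move=> t1; rewrite /excess_sq /dexcess_sq max_l ?subr_ge0. Qed.

Lemma is_derive_excess_sq t : is_derive t 1 excess_sq (dexcess_sq t).
Proof.
apply: is_derive1_quadratic_bound => h; rewrite ler_norml /excess_sq /dexcess_sq.
by case: (leP (t - 1) 0) => ?; case: (leP (t + h - 1) 0) => ?; apply/andP; split; nra.
Qed.

Lemma continuous_excess_sq : continuous excess_sq.
Proof.
move=> t; apply: differentiable_continuous; apply/derivable1_diffP.
by have [] := is_derive_excess_sq t.
Qed.

Lemma continuous_dexcess_sq : continuous dexcess_sq.
Proof.
move=> t; apply: (@continuousM _ _ (cst 2) (fun t => Num.max (t - 1) 0)); first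
  exact: cst_continuous.
apply: (@continuous_max _ _ (fun t => t - 1) (cst 0)).
  by apply: continuousB; [exact: cvg_id|exact: cst_continuous].
exact: cst_continuous.
Qed.

Definition quadr t : R := t ^+ 2 + 4 * t + 1.

(** Equal to t for t >= 1, and positive on the whole half-line, unlike t.  It
    replaces the denominator t of the outer formula for the real profile. *)
Definition paste_den t : R := t ^+ 2 - t + 1 - excess_sq t.

(** The profile f with A = f(|x|^2) mc_form.  A single formula, C^1 in t, for the
    pasted solution: see [real_profile_le1] and [real_profile_ge1]. *)
Definition real_profile t : R := (3 + excess_sq t / paste_den t) / quadr t.
Definition dreal_profile t : R :=
  ((dexcess_sq t * paste_den t - excess_sq t * (2 * t - 1 - dexcess_sq t)) /
    paste_den t ^+ 2 * quadr t
   - (3 + excess_sq t / paste_den t) * (2 * t + 4)) / quadr t ^+ 2.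

(** The profile g with phi = eps g(|x|^2) mc_form: a single rational function on
    both sides of its pole t = 1. *)
Definition imag_profile t : R := - (3 * (t + 1)) / ((t - 1) * quadr t).
Definition dimag_profile t : R :=
  - (3 * (t - 1) * quadr t - 3 * (t + 1) * (quadr t + (t - 1) * (2 * t + 4)))
  / ((t - 1) * quadr t) ^+ 2.

Lemma quadr_gt0 t : 0 <= t -> 0 < quadr t.
Proof. by rewrite /quadr => t0; nra. Qed.

Lemma paste_den_gt0 t : 0 <= t -> 0 < paste_den t.
Proof.
rewrite /paste_den => t0; have [t1|/ltW t1] := leP t 1.
  by have [-> _] := excess_sq_le1 t1; nra.
by have [-> _] := excess_sq_ge1 t1; nra.
Qed.

Lemma real_profile_le1 t : 0 <= t <= 1 ->
  real_profile t = 3 / quadr t /\ dreal_profile t = - (6 * (t + 2)) / quadr t ^+ 2.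
Proof.
move=> /andP[t0 t1]; have [p0 dp0] := excess_sq_le1 t1.
have d0 := lt0r_neq0 (paste_den_gt0 t0); have q0 := lt0r_neq0 (quadr_gt0 t0).
rewrite /real_profile /dreal_profile p0 dp0; split; first by rewrite mul0r addr0.
by field; rewrite d0 q0.
Qed.

Lemma real_profile_ge1 t : 1 <= t ->
  real_profile t = (t ^+ 2 + t + 1) / (t * quadr t) /\
  dreal_profile t = - (t ^+ 4 + 2 * t ^+ 3 + 6 * t ^+ 2 + 8 * t + 1) /
    (t * quadr t) ^+ 2.
Proof.
move=> t1; have [p0 dp0] := excess_sq_ge1 t1; have t0 : 0 < t by lra.
have q0 := lt0r_neq0 (quadr_gt0 (ltW t0)); have d0 := lt0r_neq0 t0.
have e : paste_den t = t by rewrite /paste_den p0; ring.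
rewrite /real_profile /dreal_profile p0 dp0 e; move: q0; rewrite /quadr => q0.
by split; field; rewrite d0 q0.
Qed.

Lemma is_derive_real_profile t : 0 <= t -> is_derive t 1 real_profile (dreal_profile t).
Proof.
move=> t0.
have d0 := lt0r_neq0 (paste_den_gt0 t0); have q0 := lt0r_neq0 (quadr_gt0 t0).
have dp := is_derive_excess_sq t.
have dd : is_derive t 1 paste_den (2 * t - 1 - dexcess_sq t).
  by apply: is_derive_eq; rewrite /GRing.scale/=; ring.
have dq : is_derive t 1 quadr (2 * t + 4).
  by apply: is_derive_eq; rewrite /GRing.scale/=; ring.
apply: (is_derive_eq (is_deriveM (is_deriveD (is_derive_cst (3 : R) t 1)
  (is_deriveM dp (is_deriveV d0 dd))) (is_deriveV q0 dq))).
by rewrite /GRing.scale/= /dreal_profile !fctE; field; rewrite d0 q0.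
Qed.

Lemma is_derive_imag_profile t : 0 <= t -> t != 1 ->
  is_derive t 1 imag_profile (dimag_profile t).
Proof.
move=> t0 t1; have q0 := lt0r_neq0 (quadr_gt0 t0).
have u0 : (t - 1) * quadr t != 0 by rewrite mulf_neq0// subr_eq0.
have du : is_derive t 1 (fun t => (t - 1) * quadr t) (quadr t + (t - 1) * (2 * t + 4)).
  by apply: is_derive_eq; rewrite /GRing.scale/=; ring.
have dn : is_derive t 1 (fun t => - (3 * (t + 1))) (- 3).
  by apply: is_derive_eq; rewrite /GRing.scale/=; ring.
have dV := @is_deriveV _ (fun t => (t - 1) * quadr t) _ _ _ u0 du.
apply: (is_derive_eq (is_deriveM dn dV)).
by rewrite /GRing.scale/= /dimag_profile; field; rewrite q0 subr_eq0.
Qed.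

(** The differential equations for h and b, written for f = (1 + h) / (2 t) and
    g = b / t as functions of t.  They are combined so that neither has a factor t
    left; this keeps their content at the origin. *)
Lemma profile_ode t : 0 <= t -> t != 1 ->
  dreal_profile t + dimag_profile t + 2 * real_profile t * imag_profile t -
    imag_profile t ^+ 2 + real_profile t ^+ 2 = 0 /\
  2 * real_profile t + t * (dreal_profile t - dimag_profile t) + 2 * t *
    real_profile t * imag_profile t - 2 * imag_profile t
    + t * imag_profile t ^+ 2 - t * real_profile t ^+ 2 = 0.
Proof.
move=> t0 t1; have q0 := lt0r_neq0 (quadr_gt0 t0).
have u0 : t - 1 != 0 by rewrite subr_eq0.
rewrite /imag_profile /dimag_profile; have [t_le1|t_ge1] := leP t 1.
  have [|-> ->] := @real_profile_le1 t; first by rewrite t0.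
  by move: q0; rewrite /quadr => q0; split; field; rewrite q0 u0.
have [-> ->] := real_profile_ge1 (ltW t_ge1); have n0 : t != 0 by lra.
by move: q0; rewrite /quadr => q0; split; field; rewrite ?q0 ?u0 ?n0.
Qed.

(** The derivative of a = t f is nonnegative: a increases from 0 to 1. *)
Lemma deriv_t_real_profile_ge0 t : 0 <= t -> 0 <= real_profile t + t * dreal_profile t.
Proof.
move=> t0; have q0 := quadr_gt0 t0; have q1 := lt0r_neq0 q0.
have [t1|/ltW t1] := leP t 1.
  have [|-> ->] := @real_profile_le1 t; first by rewrite t0.
  rewrite [leRHS](_ : _ = 3 * (1 - t) * (1 + t) / quadr t ^+ 2).
    by rewrite divr_ge0 ?exprn_ge0 ?(ltW q0)// !mulr_ge0//; lra.
  by move: q1; rewrite /quadr => q1; field.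
have [-> ->] := real_profile_ge1 t1; have n0 : t != 0 by lra.
rewrite [leRHS](_ : _ = 3 * (t - 1) * (t + 1) / quadr t ^+ 2).
  by rewrite divr_ge0 ?exprn_ge0 ?(ltW q0)// !mulr_ge0//; lra.
by move: q1; rewrite /quadr => q1; field; rewrite q1 n0.
Qed.

(** This is (a - a^2) / t, nonnegative because a lies between 0 and 1. *)
Lemma real_profile_gap_ge0 t : 0 <= t -> 0 <= real_profile t - t * real_profile t ^+ 2.
Proof.
move=> t0; have q0 := quadr_gt0 t0; have q1 := lt0r_neq0 q0.
have -> : real_profile t - t * real_profile t ^+ 2 = 3 * (t ^+ 2 + t + 1) /
  quadr t ^+ 2.
  have [t1|/ltW t1] := leP t 1.
    have [|-> _] := @real_profile_le1 t; first by rewrite t0.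
    by move: q1; rewrite /quadr => q1; field.
  have [-> _] := real_profile_ge1 t1; have n0 : t != 0 by lra.
  by move: q1; rewrite /quadr => q1; field; rewrite q1 n0.
by rewrite divr_ge0 ?exprn_ge0 ?(ltW q0)// mulr_ge0// !addr_ge0// exprn_ge0.
Qed.

(** The density of tr (F_A /\ F_A) at |x|^2 = t, up to the sign eps. *)
Definition charge_density t : R := 24 * (real_profile t + t * dreal_profile t) *
  (real_profile t - t * real_profile t ^+ 2).

Lemma charge_density_ge0 t : 0 <= t -> 0 <= charge_density t.
Proof.
by move=> t0; rewrite mulr_ge0 ?mulr_ge0 ?deriv_t_real_profile_ge0
  ?real_profile_gap_ge0.
Qed.

Lemma continuous_charge_density t : 0 <= t -> {for t, continuous charge_density}.
Proof.
move=> t0.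
have d0 := lt0r_neq0 (paste_den_gt0 t0); have q0 := lt0r_neq0 (quadr_gt0 t0).
have cp : {for t, continuous excess_sq} by exact: continuous_excess_sq.
have cdp : {for t, continuous dexcess_sq} by exact: continuous_dexcess_sq.
have cC c : {for t, continuous (fun=> c : R)} by exact: cst_continuous.
have cI : {for t, continuous (fun t : R => t)} by exact: cvg_id.
have cD (f g : R -> R) : {for t, continuous f} -> {for t, continuous g} ->
  {for t, continuous (fun t => f t + g t)} by exact: continuousD.
have cM (f g : R -> R) : {for t, continuous f} -> {for t, continuous g} ->
  {for t, continuous (fun t => f t * g t)} by exact: continuousM.
have cN (f : R -> R) : {for t, continuous f} -> {for t, continuous (fun t => - f t)}
  by exact: continuousN.
have cX (f : R -> R) n : {for t, continuous f} ->
  {for t, continuous (fun t => f t ^+ n)}.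
  move=> cf; apply: (@continuous_comp _ _ _ f (fun u => u ^+ n) t cf).
  exact: exprn_continuous.
have cV (f : R -> R) : f t != 0 -> {for t, continuous f} ->
  {for t, continuous (fun t => (f t)^-1)} by move=> f0; exact: continuousV.
have cq : {for t, continuous quadr}.
  exact: (cD _ _ (cD _ _ (cX _ 2 cI) (cM _ _ (cC 4) cI)) (cC 1)).
have cd : {for t, continuous paste_den}.
  exact: (cD _ _ (cD _ _ (cD _ _ (cX _ 2 cI) (cN _ cI)) (cC 1)) (cN _ cp)).
have cpd := cD _ _ (cC 3) (cM _ _ cp (cV paste_den d0 cd)).
have cf : {for t, continuous real_profile} by exact: (cM _ _ cpd (cV quadr q0 cq)).
have cX2 := cV (fun t => quadr t ^+ 2) (expf_neq0 2 q0) (cX _ 2 cq).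
have cX3 := cV (fun t => paste_den t ^+ 2) (expf_neq0 2 d0) (cX _ 2 cd).
have cdf : {for t, continuous dreal_profile}.
  have c1 := cD _ _ (cM _ _ (cC 2) cI) (cC (- 1)).
  have c2 := cM _ _ cp (cD _ _ c1 (cN _ cdp)).
  have c3 := cM _ _ (cM _ _ (cD _ _ (cM _ _ cdp cd) (cN _ c2)) cX3) cq.
  have c4 := cM _ _ cpd (cD _ _ (cM _ _ (cC 2) cI) (cC 4)).
  exact: (cM _ _ (cD _ _ c3 (cN _ c4)) cX2).
have ca := cM _ _ (cC 24) (cD _ _ cf (cM _ _ cI cdf)).
exact: (cM _ _ ca (cD _ _ cf (cN _ (cM _ _ cI (cX _ 2 cf))))).
Qed.

(** With a = t f, the integrand t * charge_density t is 24 a' (a - a^2). *)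
Lemma is_derive_charge t : 0 <= t ->
  is_derive t 1 (fun t => 12 * (t * real_profile t) ^+ 2 - 8 *
    (t * real_profile t) ^+ 3)
    (t * charge_density t).
Proof.
move=> /is_derive_real_profile dp.
have da : is_derive t 1 (fun t => t * real_profile t) (real_profile t + t *
  dreal_profile t).
  by apply: is_derive_eq; rewrite /GRing.scale/=; ring.
have d2 := is_deriveM (is_derive_cst (12 : R) t 1) (is_deriveX 2 da).
have d3 := is_deriveM (is_derive_cst (8 : R) t 1) (is_deriveX 3 da).
apply: (is_derive_eq (is_deriveB d2 d3)).
by rewrite /GRing.scale/= /charge_density !fctE; ring.
Qed.

Lemma cvg_charge :
  12 * (t * real_profile t) ^+ 2 - 8 * (t * real_profile t) ^+ 3 @[t --> +oo] -->
    (4 : R).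
Proof.
have ca : t * real_profile t @[t --> +oo] --> (1 : R).
  apply/cvgrPdist_le => /= e e0; near=> t.
  have t1 : 1 <= t by near: t; apply: nbhs_pinfty_ge; rewrite num_real.
  have te : 3 / e <= t by near: t; apply: nbhs_pinfty_ge; rewrite num_real.
  have t0 : 0 < t by lra.
  have [-> _] := real_profile_ge1 t1; have q0 := quadr_gt0 (ltW t0).
  have -> : 1 - t * ((t ^+ 2 + t + 1) / (t * quadr t)) = 3 * t / quadr t.
    by move: (lt0r_neq0 q0) (lt0r_neq0 t0); rewrite /quadr => ? ?; field; apply/andP.
  rewrite ger0_norm ?divr_ge0 ?mulr_ge0 ?(ltW q0) ?(ltW t0)//.
  rewrite ler_pdivrMr//; move: te; rewrite ler_pdivrMr// => te.
  have : 0 < t * e by rewrite mulr_gt0.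
  by rewrite /quadr; nra.
have -> : 4 = 12 * 1 ^+ 2 - 8 * 1 ^+ 3 :> R by ring.
have cX n : (t * real_profile t) ^+ n @[t --> +oo] --> (1 ^+ n : R).
  exact: (cvg_comp _ _ ca (@exprn_continuous _ n 1)).
by apply: cvgB; apply: cvgM; first [exact: cvg_cst|exact: cX].
Unshelve. all: by end_near. Qed.

Local Notation mu := (@lebesgue_measure R).

Lemma integral_charge_density :
  (\int[mu]_(s in `[0%R, +oo[) (s * charge_density s)%:E = 4%:E)%E.
Proof.
have cont (s : R) : 0 <= s -> {for s, continuous (fun u : R => u * charge_density u)}.
  move=> s0; apply: (@continuousM _ _ (fun u : R => u) charge_density s).
    exact: cvg_id.
  exact: continuous_charge_density.
rewrite (@ge0_continuous_FTC2y _ _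
  (fun t => 12 * (t * real_profile t) ^+ 2 - 8 * (t * real_profile t) ^+ 3) 0 4).
- by rewrite !mul0r !expr0n !mulr0 subr0 sube0.
- by move=> s s0; rewrite mulr_ge0 ?charge_density_ge0.
- apply/continuous_within_itvcyP; split.
    move=> s; rewrite in_itv/= andbT => /ltW; exact: cont.
  by apply: cvg_at_right_filter; exact: cont.
- exact: cvg_charge.
- by move=> s /ltW s0; have [] := is_derive_charge s0.
- have [/derivable1_diffP/differentiable_continuous c0 _] := is_derive_charge (lexx 0).
  by apply: cvg_at_right_filter; exact: c0.
- move=> s; rewrite in_itv/= andbT => /ltW s0.
  by rewrite derive1E; have [_ ->] := is_derive_charge s0.
Qed.

End RadialProfile.

(** * Differential forms in coordinates *)

Section Components.
Context {R : realType}.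
Local Notation V := 'rV[R]_4.
Implicit Types (a A phi : oneform R) (x : V) (S : {set 'I_4}).

(** Subsets of {0, 1, 2, 3} by their indicator bits, so that the combinatorics of
    exterior algebra is settled by computation on booleans. *)
Definition bitset (b0 b1 b2 b3 : bool) : {set 'I_4} :=
  [set i : 'I_4 | nth false [:: b0; b1; b2; b3] i].

Lemma bitsetP S : exists b0 b1 b2 b3, S = bitset b0 b1 b2 b3.
Proof.
exists (0 \in S), (1 \in S), (2 \in S), (3 \in S).
apply/setP => -[[|[|[|[|//]]]] lt4]; rewrite inE/=; congr (_ \in S); exact: val_inj.
Qed.

Lemma big4E (T : Type) (idx : T) (op : Monoid.law idx) (F : 'I_4 -> T) :
  \big[op/idx]_(i < 4) F i = op (op (op (F 0) (F 1)) (F 2)) (F 3).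
Proof.
rewrite !big_ord_recl big_ord0 Monoid.mulm1 !Monoid.mulmA.
by congr (op (op (op (F _) (F _)) (F _)) (F _)); apply: val_inj.
Qed.

Lemma bitset_set1 :
  [/\ [set 0]%SET = bitset true false false false,
      [set 1]%SET = bitset false true false false,
      [set 2]%SET = bitset false false true false &
      [set 3]%SET = bitset false false false true].
Proof. by split; apply/setP => -[[|[|[|[|//]]]] lt4]; rewrite !inE. Qed.

Lemma bitset_eq b0 b1 b2 b3 c0 c1 c2 c3 :
  (bitset b0 b1 b2 b3 == bitset c0 c1 c2 c3) =
  [&& b0 == c0, b1 == c1, b2 == c2 & b3 == c3].
Proof.
apply/eqP/and4P => [/setP E|[/eqP-> /eqP-> /eqP-> /eqP->]//].
by have := (E 0, E 1, E 2, E 3); rewrite !inE/= => -[[[-> ->] ->] ->].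
Qed.

Lemma bitsetC b0 b1 b2 b3 :
  ~: bitset b0 b1 b2 b3 = bitset (~~ b0) (~~ b1) (~~ b2) (~~ b3).
Proof. by apply/setP => -[[|[|[|[|//]]]] lt4]; rewrite !inE. Qed.

Lemma bitsetD b0 b1 b2 b3 c0 c1 c2 c3 :
  bitset b0 b1 b2 b3 :\: bitset c0 c1 c2 c3 =
  bitset (~~ c0 && b0) (~~ c1 && b1) (~~ c2 && b2) (~~ c3 && b3).
Proof. by apply/setP => -[[|[|[|[|//]]]] lt4]; rewrite !inE. Qed.

Lemma mem_bitset b0 b1 b2 b3 :
  [/\ (0 \in bitset b0 b1 b2 b3) = b0, (1 \in bitset b0 b1 b2 b3) = b1,
      (2 \in bitset b0 b1 b2 b3) = b2 & (3 \in bitset b0 b1 b2 b3) = b3].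
Proof. by rewrite !inE. Qed.

Lemma dxsign_bitset b0 b1 b2 b3 c0 c1 c2 c3 :
  dxsign (bitset b0 b1 b2 b3) (bitset c0 c1 c2 c3) =
  (-1) ^+ (b1 * c0 + b2 * (c0 + c1) + b3 * (c0 + c1 + c2))%N :> R.
Proof.
congr (_ ^+ _); rewrite -sum1dep_card big_mkcond/=.
transitivity (\sum_(i < 4) \sum_(j < 4) (nth false [:: b0; b1; b2; b3] i &&
    nth false [:: c0; c1; c2; c3] j && (j < i)%N : nat))%N.
  rewrite pair_bigA; apply: eq_bigr => -[i j] _ /=; rewrite !inE.
  by rewrite andbA; case: (_ && _).
rewrite !big4E/= !andbF !andbT.
by move: b1 b2 b3 c0 c1 c2 => [] [] [] [] [] [].
Qed.

Lemma quat_eq (x y : V) : x 0 0 = y 0 0 -> x 0 1 = y 0 1 -> x 0 2 = y 0 2 ->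
  x 0 3 = y 0 3 -> x = y.
Proof.
move=> e0 e1 e2 e3; apply/rowP => j.
case: j => [[|[|[|[|//]]]] lt4].
- by rewrite (_ : Ordinal lt4 = 0) //; exact: val_inj.
- by rewrite (_ : Ordinal lt4 = 1) //; exact: val_inj.
- by rewrite (_ : Ordinal lt4 = 2) //; exact: val_inj.
- by rewrite (_ : Ordinal lt4 = 3) //; exact: val_inj.
Qed.

Lemma mkquat0 (a b c d : R) : mkquat a b c d 0 0 = a. Proof. by rewrite mxE. Qed.
Lemma mkquat1 (a b c d : R) : mkquat a b c d 0 1 = b. Proof. by rewrite mxE. Qed.
Lemma mkquat2 (a b c d : R) : mkquat a b c d 0 2 = c. Proof. by rewrite mxE. Qed.
Lemma mkquat3 (a b c d : R) : mkquat a b c d 0 3 = d. Proof. by rewrite mxE. Qed.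
Definition mkquatE := (mkquat0, mkquat1, mkquat2, mkquat3).

Lemma qmulDl (x y z : V) : qmul (x + y) z = qmul x z + qmul y z.
Proof. by apply: quat_eq; rewrite /qmul !mxE/=; ring. Qed.

Lemma qmulDr (x y z : V) : qmul z (x + y) = qmul z x + qmul z y.
Proof. by apply: quat_eq; rewrite /qmul !mxE/=; ring. Qed.

Lemma qmul0l (x : V) : qmul 0 x = 0.
Proof. by apply: quat_eq; rewrite /qmul !mxE/=; ring. Qed.

Lemma qmul0r (x : V) : qmul x 0 = 0.
Proof. by apply: quat_eq; rewrite /qmul !mxE/=; ring. Qed.

(** A 1-form contributes only the singletons T = {i} to the sum defining a wedge
    product. *)
Lemma wedge_of1l a (be : Defs.form R) S x :
  wedge (of1 a) be S x = \sum_(i < 4 | i \in S)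
    dxsign [set i]%SET (S :\ i)%SET *: qmul (a i x) (be (S :\ i)%SET x).
Proof.
rewrite /wedge /of1.
transitivity (\sum_(T : {set 'I_4} | T \subset S) \sum_(i < 4 | T == [set i]%SET)
    dxsign T (S :\: T)%SET *: qmul (a i x) (be (S :\: T)%SET x)).
  apply: eq_bigr => T _; rewrite -scaler_sumr; congr (_ *: _).
  by apply: (big_morph (fun u => qmul u _)) => [u v|]; rewrite ?qmulDl ?qmul0l.
rewrite (exchange_big_dep (fun i => i \in S)) /=; last first.
  by move=> T i TS /eqP Ti; move: TS; rewrite Ti finset.sub1set.
apply: eq_bigr => i iS; rewrite (big_pred1 [set i]%SET)// => T /=.
by case: eqP => [->|]; rewrite ?andbF ?finset.sub1set ?iS.
Qed.

Lemma wedge_of1r a (be : Defs.form R) S x :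
  wedge be (of1 a) S x = \sum_(i < 4 | i \in S)
    dxsign (S :\ i)%SET [set i]%SET *: qmul (be (S :\ i)%SET x) (a i x).
Proof.
rewrite /wedge /of1.
transitivity (\sum_(T : {set 'I_4} | T \subset S) \sum_(i < 4 | (S :\: T)%SET ==
  [set i]%SET)
    dxsign T (S :\: T)%SET *: qmul (be T x) (a i x)).
  apply: eq_bigr => T _; rewrite -scaler_sumr; congr (_ *: _).
  by apply: (big_morph (fun u => qmul _ u)) => [u v|]; rewrite ?qmulDr ?qmul0r.
rewrite (exchange_big_dep (fun i => i \in S)) /=; last first.
  by move=> T i TS /eqP Ti; have /setDP[] : i \in (S :\: T)%SET by rewrite Ti inE.
apply: eq_bigr => i iS; rewrite (big_pred1 (S :\ i)%SET) => [|T /=].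
  by rewrite finset.setDDr finset.setDv finset.set0U (finset.setIidPr _)//
    finset.sub1set.
apply/andP/eqP => [[TS /eqP ST]|->].
  by rewrite -ST finset.setDDr finset.setDv finset.set0U (finset.setIidPr TS).
by rewrite finset.subsetDl finset.setDDr finset.setDv finset.set0U (finset.setIidPr
  _)// finset.sub1set.
Qed.

Definition of1_bits a (b0 b1 b2 b3 : bool) : V -> V :=
  match b0, b1, b2, b3 with
  | true, false, false, false => a 0
  | false, true, false, false => a 1
  | false, false, true, false => a 2
  | false, false, false, true => a 3
  | _, _, _, _ => fun=> 0
  end.

Lemma of1_bitset a b0 b1 b2 b3 : of1 a (bitset b0 b1 b2 b3) = of1_bits a b0 b1 b2 b3.
Proof.
have [s0 s1 s2 s3] := bitset_set1.
apply/funext => x; rewrite /of1 big_mkcond big4E/= s0 s1 s2 s3 !bitset_eq.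
by move: b0 b1 b2 b3 => [] [] [] []; rewrite /= ?addr0 ?add0r.
Qed.

Lemma star_bitset (al : Defs.form R) b0 b1 b2 b3 x :
  star al (bitset b0 b1 b2 b3) x =
  (-1) ^+ (~~ b1 * b0 + ~~ b2 * (b0 + b1) + ~~ b3 * (b0 + b1 + b2))%N
    *: al (bitset (~~ b0) (~~ b1) (~~ b2) (~~ b3)) x.
Proof. by rewrite /star bitsetC dxsign_bitset. Qed.

(** The components of the 2-form with coefficients c i j for i < j. *)
Definition two_bits (c : 'I_4 -> 'I_4 -> V) (b0 b1 b2 b3 : bool) : V :=
  match b0, b1, b2, b3 with
  | true, true, false, false => c 0 1
  | true, false, true, false => c 0 2
  | true, false, false, true => c 0 3
  | false, true, true, false => c 1 2
  | false, true, false, true => c 1 3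
  | false, false, true, true => c 2 3
  | _, _, _, _ => 0
  end.

Lemma pderiv0 i x : pderiv i (fun=> 0) x = 0.
Proof. exact: derive_cst. Qed.

Definition bitsetE := (dxsign_bitset, bitsetD, bitsetC).

Lemma extd_of1 a b0 b1 b2 b3 x :
  extd (of1 a) (bitset b0 b1 b2 b3) x =
  two_bits (fun i j => pderiv i (a j) x - pderiv j (a i) x) b0 b1 b2 b3.
Proof.
have [s0 s1 s2 s3] := bitset_set1; have [m0 m1 m2 m3] := mem_bitset b0 b1 b2 b3.
rewrite /extd big_mkcond big4E/= m0 m1 m2 m3 s0 s1 s2 s3 !bitsetE !of1_bitset.
move: b0 b1 b2 b3 {m0 m1 m2 m3} => [] [] [] [] /=;
  by rewrite ?pderiv0 ?scaler0 ?addr0 ?add0r ?expr0 ?expr1 ?scale1r ?scaleN1r ?addr0 //;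
     rewrite addrC.
Qed.

Lemma wedge_of1 a (b : oneform R) b0 b1 b2 b3 x :
  wedge (of1 a) (of1 b) (bitset b0 b1 b2 b3) x =
  two_bits (fun i j => qmul (a i x) (b j x) - qmul (a j x) (b i x)) b0 b1 b2 b3.
Proof.
have [s0 s1 s2 s3] := bitset_set1; have [m0 m1 m2 m3] := mem_bitset b0 b1 b2 b3.
rewrite wedge_of1l big_mkcond big4E/= m0 m1 m2 m3 s0 s1 s2 s3 !bitsetE !of1_bitset.
move: b0 b1 b2 b3 {m0 m1 m2 m3} => [] [] [] [] /=;
  by rewrite ?qmul0r ?scaler0 ?addr0 ?add0r ?expr0 ?expr1 ?scale1r ?scaleN1r ?addr0 //;
     rewrite addrC.
Qed.

Lemma two_bitsD (c d : 'I_4 -> 'I_4 -> V) b0 b1 b2 b3 :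
  two_bits c b0 b1 b2 b3 + two_bits d b0 b1 b2 b3 =
  two_bits (fun i j => c i j + d i j) b0 b1 b2 b3.
Proof. by move: b0 b1 b2 b3 => [] [] [] []; rewrite /= ?addr0. Qed.

Lemma curvature_bitset A b0 b1 b2 b3 x :
  curvature A (bitset b0 b1 b2 b3) x =
  two_bits (fun i j => pderiv i (A j) x - pderiv j (A i) x +
    (qmul (A i x) (A j x) - qmul (A j x) (A i x))) b0 b1 b2 b3.
Proof. by rewrite /curvature /addform extd_of1 wedge_of1 two_bitsD. Qed.

Lemma covd_of1_bitset A phi b0 b1 b2 b3 x :
  covd A (of1 phi) (bitset b0 b1 b2 b3) x =
  two_bits (fun i j => pderiv i (phi j) x - pderiv j (phi i) x +
    (qmul (A i x) (phi j x) - qmul (A j x) (phi i x) +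
     (qmul (phi i x) (A j x) - qmul (phi j x) (A i x)))) b0 b1 b2 b3.
Proof. by rewrite /covd /addform extd_of1 !wedge_of1 !two_bitsD. Qed.

Lemma star_of1 phi b0 b1 b2 b3 :
  star (of1 phi) (bitset b0 b1 b2 b3) =
  match b0, b1, b2, b3 with
  | false, true, true, true => phi 0
  | true, false, true, true => fun x => - phi 1 x
  | true, true, false, true => phi 2
  | true, true, true, false => fun x => - phi 3 x
  | _, _, _, _ => fun=> 0
  end.
Proof.
apply/funext => x; rewrite star_bitset of1_bitset.
move: b0 b1 b2 b3 => [] [] [] [] /=; rewrite ?scaler0 ?expr0 ?scale1r//.
all: by rewrite -signr_odd/= ?expr0 ?expr1 ?scale1r ?scaleN1r.
Qed.

Lemma qmulNl (x y : V) : qmul (- x) y = - qmul x y.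
Proof. by apply: quat_eq; rewrite /qmul !mxE/=; ring. Qed.

Lemma qmulNr (x y : V) : qmul x (- y) = - qmul x y.
Proof. by apply: quat_eq; rewrite /qmul !mxE/=; ring. Qed.

(** In degree 4 the signs of the star and of the wedge product cancel, and
    d_A star phi is the covariant divergence of phi. *)
Lemma covd_star_of1 A phi S x :
  (forall i, derivable (phi i) x (delta_mx 0 i)) ->
  (\sum_(i < 4) (pderiv i (phi i) x +
    (qmul (A i x) (phi i x) - qmul (phi i x) (A i x))) = 0) ->
  covd A (star (of1 phi)) S x = 0.
Proof.
move=> dphi; rewrite big4E/= => div0.
have [b0 [b1 [b2 [b3 ->]]]] := bitsetP S.
have rearrange (p0 p1 p2 p3 q0 q1 q2 q3 r0 r1 r2 r3 : V) :
    p0 + p1 + p2 + p3 + (q0 + q1 + q2 + q3 + (- r0 - r1 - r2 - r3)) =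
    p0 + (q0 - r0) + (p1 + (q1 - r1)) + (p2 + (q2 - r2)) + (p3 + (q3 - r3)).
  by apply: quat_eq; rewrite !mxE; ring.
have sign_odd n : (-1) ^+ n = (if odd n then -1 else 1) :> R.
  by rewrite -signr_odd; case: odd.
have pderivN i : pderiv i (fun y => - phi i y) x = - pderiv i (phi i) x.
  by rewrite /pderiv; exact: deriveN.
have [s0 s1 s2 s3] := bitset_set1; have [m0 m1 m2 m3] := mem_bitset b0 b1 b2 b3.
rewrite /covd /addform wedge_of1l wedge_of1r /extd !(big_mkcond (fun i => i \in _)).
rewrite !big4E/= m0 m1 m2 m3 s0 s1 s2 s3 !bitsetE !star_of1.
move: b0 b1 b2 b3 {m0 m1 m2 m3} => [] [] [] [] /=.
all: rewrite ?pderiv0 ?qmul0l ?qmul0r ?scaler0 ?addr0 ?add0r//.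
rewrite !pderivN !sign_odd/= ?scale1r ?scaleN1r !qmulNl !qmulNr.
rewrite -[RHS]div0 !opprK; exact: rearrange.
Qed.

End Components.

(** * The rotationally invariant ansatz *)

Section Instanton.
Context {R : realType}.
Local Notation V := 'rV[R]_4.
Implicit Types (x y v : V) (eps : R).

Definition basis_vec (i : 'I_4) : V := delta_mx 0 i.

(** The identity for eps = 1 and the conjugation for eps = - 1. *)
Definition twist eps x : V := mkquat (x 0 0) (eps * x 0 1) (eps * x 0 2) (eps * x 0 3).

Definition qim x : V := mkquat 0 (x 0 1) (x 0 2) (x 0 3).

(** The 1-form Im (x dxbar) for eps = 1, Im (xbar dx) for eps = - 1, at the point x
    and evaluated on the vector v. *)
Definition mc_form eps (v x : V) : V := qim (qmul (twist eps x) (qconj (twist eps v))).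

Lemma mcformE eps v x : eps = 1 \/ eps = - 1 -> mc_form eps v x = mkquat 0
  (eps * (x 0 1 * v 0 0 - x 0 0 * v 0 1) + x 0 3 * v 0 2 - x 0 2 * v 0 3)
  (eps * (x 0 2 * v 0 0 - x 0 0 * v 0 2) + x 0 1 * v 0 3 - x 0 3 * v 0 1)
  (eps * (x 0 3 * v 0 0 - x 0 0 * v 0 3) + x 0 2 * v 0 1 - x 0 1 * v 0 2).
Proof.
move=> heps; apply: quat_eq; rewrite /mc_form /qim /qmul /qconj /twist !mkquatE//;
  by case: heps => ->; ring.
Qed.

(** Directional derivatives are derivatives along lines, where the chain rule in one
    variable applies. *)
Lemma is_derive_line (F : V -> R) x v d :
  is_derive (0 : R) 1 (fun h => F (h *: v + x)) d -> is_derive x v F d.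
Proof.
move=> [dF FE]; have dx : derivable F x v by apply/(derivable1P F x v).
apply: DeriveDef dx _.
rewrite -FE /derive; set g1 := fun h => h^-1 *: _; set g2 := fun h => h^-1 *: _.
suff -> : g1 = g2 by [].
by apply/funext => h; rewrite /g1 /g2/= addr0 scale0r add0r [_%:A]mulr1.
Qed.

Lemma qnormsqE x : qnormsq x = x 0 0 ^+ 2 + x 0 1 ^+ 2 + x 0 2 ^+ 2 + x 0 3 ^+ 2.
Proof. by rewrite /qnormsq big4E. Qed.

Lemma qnormsq_line (h : R) (i : 'I_4) x :
  qnormsq (h *: basis_vec i + x) = qnormsq x + 2 * x 0 i * h + h ^+ 2.
Proof.
rewrite /qnormsq (bigD1 i)//= [in RHS](bigD1 i)//= !mxE !eqxx mulr1.
under eq_bigr => j ji do rewrite !mxE (negbTE ji) andbF mulr0 add0r.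
by ring.
Qed.

Lemma is_derive_radial (f : R -> R) x i d :
  is_derive (qnormsq x) 1 f d ->
  is_derive x (basis_vec i) (fun y => f (qnormsq y)) (d * (2 * x 0 i)).
Proof.
move=> df; apply: is_derive_line.
under eq_fun do rewrite qnormsq_line.
pose q (h : R) := qnormsq x + 2 * x 0 i * h + h ^+ 2.
have q0 : q 0 = qnormsq x by rewrite /q; ring.
have dq : is_derive (0 : R) 1 q (2 * x 0 i).
  by apply: is_derive_eq; rewrite /GRing.scale/=; ring.
by apply: (@is_derive1_comp _ f q); rewrite ?q0.
Qed.

Lemma is_derive_linear (F : V -> V) x v :
  (forall h : R, F (h *: v + x) = h *: F v + F x) -> is_derive x v F (F v).
Proof.
move=> Flin.
have cv : h^-1 *: ((F \o shift x) (h *: v) - F x) @[h --> (0 : R)^'] --> F v.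
  apply: cvg_near_cst; near=> h.
  have h0 : h != 0 by near: h; exact: nbhs_dnbhs_neq.
  by rewrite /= Flin addrK scalerA mulVf// scale1r.
by apply: DeriveDef; [apply/cvg_ex; exists (F v)|apply/cvg_lim].
Unshelve. all: by end_near. Qed.

Lemma is_derive_mc_form eps w x v : eps = 1 \/ eps = - 1 ->
  is_derive x v (mc_form eps w) (mc_form eps w v).
Proof.
move=> heps; apply: is_derive_linear => h; rewrite !mcformE//.
have linE (u y : V) k : (h *: u + y) 0 k = h * u 0 k + y 0 k by rewrite !mxE.
by apply: quat_eq; rewrite !(linE, mkquatE); ring.
Qed.

Lemma is_derive_radial_form eps (f : R -> R) w x i d :
  eps = 1 \/ eps = - 1 -> is_derive (qnormsq x) 1 f d ->
  is_derive x (basis_vec i) (fun y => f (qnormsq y) *: mc_form eps w y)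
    ((d * (2 * x 0 i)) *: mc_form eps w x + f (qnormsq x) *:
      mc_form eps w (basis_vec i)).
Proof.
move=> heps df; apply: is_derive_row => j.
have dj : is_derive x (basis_vec i) (fun y =>
  mc_form eps w y 0 j) (mc_form eps w (basis_vec i) 0 j).
  have [dm] := is_derive_mc_form w x (basis_vec i) heps.
  rewrite derive_mx// => /rowP/(_ j); rewrite mxE => E.
  by apply: DeriveDef => //; move/derivable_mxP: dm; exact.
have := is_deriveM (is_derive_radial i df) dj.
rewrite (_ : (_ * _)%R = (fun y => (f (qnormsq y) *: mc_form eps w y) 0 j)); last first.
  by apply/funext => y; rewrite mxE.
move=> H; apply: is_derive_eq H _.
have linE a b (u y : V) k : (a *: u + b *: y) 0 k = a * u 0 k + b * y 0 k.
  by rewrite !mxE.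
by rewrite linE /GRing.scale/=; ring.
Qed.

Definition real_part eps : oneform R := fun i x => real_profile (qnormsq x) *:
  mc_form eps (basis_vec i) x.

Definition imag_part eps : oneform R := fun i x =>
  (eps * imag_profile (qnormsq x)) *: mc_form eps (basis_vec i) x.

Lemma qnormsq_ge0 x : 0 <= qnormsq x.
Proof. by apply: sumr_ge0 => i _; exact: sqr_ge0. Qed.

Lemma off_sphere x : (~` sphere 1) x <-> qnormsq x != 1.
Proof.
rewrite /sphere /qnorm /=; split=> [x1|/eqP x1 /(congr1 (fun u => u ^+ 2))].
  by apply/eqP => x1'; apply: x1; rewrite x1' sqrtr1.
by rewrite sqr_sqrtr ?qnormsq_ge0// expr1n.
Qed.

Lemma is_derive_real_part eps j x i : eps = 1 \/ eps = - 1 ->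
  is_derive x (basis_vec i) (real_part eps j) ((dreal_profile (qnormsq x) *
    (2 * x 0 i)) *:
    mc_form eps (basis_vec j) x + real_profile (qnormsq x) *:
      mc_form eps (basis_vec j) (basis_vec i)).
Proof.
move=> heps; have dp := is_derive_real_profile (qnormsq_ge0 x).
exact: (is_derive_radial_form (basis_vec j) i heps dp).
Qed.

Lemma is_derive_imag_part eps j x i : eps = 1 \/ eps = - 1 -> qnormsq x != 1 ->
  is_derive x (basis_vec i) (imag_part eps j) ((eps * dimag_profile (qnormsq x) *
    (2 * x 0 i)) *:
    mc_form eps (basis_vec j) x + (eps * imag_profile (qnormsq x)) *:
      mc_form eps (basis_vec j) (basis_vec i)).
Proof.
move=> heps x1; have ds := is_derive_imag_profile (qnormsq_ge0 x) x1.
have des : is_derive (qnormsq x) 1 (fun t => eps * imag_profile t) (eps *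
  dimag_profile (qnormsq x)).
  by apply: is_derive_eq; rewrite /GRing.scale/=; ring.
exact: (is_derive_radial_form (basis_vec j) i heps des).
Qed.

End Instanton.

(** * Reduction of the equations to the profiles *)

Section KWEquations.
Context {R : realType}.
Local Notation V := 'rV[R]_4.
Implicit Types (x y v : V) (eps : R).

Lemma mkquatD (a b c d a' b' c' d' : R) : mkquat a b c d + mkquat a' b' c' d' =
  mkquat (a + a') (b + b') (c + c') (d + d').
Proof. by apply: quat_eq; rewrite !mxE. Qed.

Lemma mkquatN (a b c d : R) : - mkquat a b c d = mkquat (- a) (- b) (- c) (- d).
Proof. by apply: quat_eq; rewrite !mxE. Qed.

Lemma mkquatZ (k a b c d : R) : k *: mkquat a b c d =
  mkquat (k * a) (k * b) (k * c) (k * d).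
Proof. by apply: quat_eq; rewrite !mxE. Qed.

Lemma qmul_mkquat (a b c d a' b' c' d' : R) :
  qmul (mkquat a b c d) (mkquat a' b' c' d') =
  mkquat (a * a' - b * b' - c * c' - d * d') (a * b' + b * a' + c * d' - d * c')
         (a * c' - b * d' + c * a' + d * b') (a * d' + b * c' - c * b' + d * a').
Proof. by rewrite /qmul !mkquatE. Qed.

Definition mkquat_simp := (qmul_mkquat, mkquatN, mkquatZ, mkquatD).

Lemma basis_vec_entry (i k : 'I_4) : basis_vec i 0 k = (k == i)%:R :> R.
Proof. by rewrite mxE. Qed.

(** The coefficients of [mc_form] on the basis vectors, see [mc_form_basis]. *)
Definition mc_coords eps (i : 'I_4) x : V :=
  match val i with
  | 0 => mkquat 0 (eps * x 0 1) (eps * x 0 2) (eps * x 0 3)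
  | 1 => mkquat 0 (- (eps * x 0 0)) (- x 0 3) (x 0 2)
  | 2 => mkquat 0 (x 0 3) (- (eps * x 0 0)) (- x 0 1)
  | _ => mkquat 0 (- x 0 2) (x 0 1) (- (eps * x 0 0))
  end.

Lemma mc_form_basis eps i x : eps = 1 \/ eps = - 1 ->
  mc_form eps (basis_vec i) x = mc_coords eps i x.
Proof.
move=> heps; rewrite mcformE// !basis_vec_entry.
by case: i => [[|[|[|[|//]]]] lt4]; rewrite /mc_coords/=; congr (mkquat _ _ _ _); ring.
Qed.

(** The i-th partial derivative of the j-th coefficient of f(|x|^2) mc_form, when f
    and f' are the values at |x|^2 of the profile and of its derivative. *)
Definition partial_mc eps (f f' : R) x (i j : 'I_4) : V :=
  (f' * (2 * x 0 i)) *: mc_coords eps j x + f *: mc_coords eps j (basis_vec i).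

Definition wedge_mc eps (f g : R) x (i j : 'I_4) : V :=
  qmul (f *: mc_coords eps i x) (g *: mc_coords eps j x) -
  qmul (f *: mc_coords eps j x) (g *: mc_coords eps i x).

Definition curv_mc eps (f f' : R) x (i j : 'I_4) : V :=
  partial_mc eps f f' x i j - partial_mc eps f f' x j i + wedge_mc eps f f x i j.

Definition covd_mc eps (f g g' : R) x (i j : 'I_4) : V :=
  partial_mc eps g g' x i j - partial_mc eps g g' x j i +
  (wedge_mc eps f g x i j + wedge_mc eps g f x i j).

Definition kw_ode1 (f f' g g' : R) : R := f' + g' + 2 * f * g - g ^+ 2 + f ^+ 2.
Definition kw_ode2 (t f f' g g' : R) : R :=
  2 * f + t * (f' - g') + 2 * t * f * g - 2 * g + t * g ^+ 2 - t * f ^+ 2.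

(** F_A - phi /\ phi - star d_A phi splits into a self-dual and an anti-self-dual
    part, one quadratic in x, the other with constant coefficients; e1 and e2 are
    their factors.  Here (k, l) is the pair complementary to (i, j) and s is
    the sign of the star on it. *)
Definition kw_combination eps (e1 e2 : R) x (s : R) (i j k l : 'I_4) : V :=
  e1 *: ((x 0 i *: mc_coords eps j x - x 0 j *: mc_coords eps i x) -
    (eps * s) *: (x 0 k *: mc_coords eps l x - x 0 l *: mc_coords eps k x)) +
  e2 *: mc_coords eps j (basis_vec i).

Section OnePoint.
Context (eps f f' g g' : R) (x : V).
Context (heps : eps = 1 \/ eps = - 1).

Local Notation kw_defect s i j k l :=
  (curv_mc eps f f' x i j - wedge_mc eps (eps * g) (eps * g) x i j -
   s *: covd_mc eps f (eps * g) (eps * g') x k l).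
Local Notation kw_odes s i j k l := (kw_combination eps (kw_ode1 f f' g g')
   (kw_ode2 (qnormsq x) f f' g g') x s i j k l).

Local Ltac kw_identity :=
  rewrite /kw_combination /kw_ode1 /kw_ode2 qnormsqE /curv_mc /covd_mc /wedge_mc
    /partial_mc /mc_coords /= !basis_vec_entry/= !mkquat_simp;
  by case: heps => ->; congr (mkquat _ _ _ _); ring.

(** The cofactors of the two equations are read off from the terms in the
    derivatives f' and g' and from the terms linear in f. *)
Lemma kw_defect01 : kw_defect 1 0 1 2 3 = kw_odes 1 0 1 2 3.
Proof. kw_identity. Qed.
Lemma kw_defect02 : kw_defect (- 1) 0 2 1 3 = kw_odes (- 1) 0 2 1 3.
Proof. kw_identity. Qed.
Lemma kw_defect03 : kw_defect 1 0 3 1 2 = kw_odes 1 0 3 1 2.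
Proof. kw_identity. Qed.
Lemma kw_defect12 : kw_defect 1 1 2 0 3 = kw_odes 1 1 2 0 3.
Proof. kw_identity. Qed.
Lemma kw_defect13 : kw_defect (- 1) 1 3 0 2 = kw_odes (- 1) 1 3 0 2.
Proof. kw_identity. Qed.
Lemma kw_defect23 : kw_defect 1 2 3 0 1 = kw_odes 1 2 3 0 1.
Proof. kw_identity. Qed.

(** mc_form is coclosed, and it vanishes on the radial direction. *)
Lemma divergence_mc : partial_mc eps g g' x 0 0 + partial_mc eps g g' x 1 1 +
  partial_mc eps g g' x 2 2 +
  partial_mc eps g g' x 3 3 = 0.
Proof.
have -> : 0 = mkquat 0 0 0 0 :> V by apply: quat_eq; rewrite !mxE.
rewrite /partial_mc /mc_coords/= !basis_vec_entry/= !mkquat_simp.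
by congr (mkquat _ _ _ _); ring.
Qed.

Definition qdot (u v : V) : R := u 0 0 * v 0 0 + u 0 1 * v 0 1 + u 0 2 * v 0 2 +
  u 0 3 * v 0 3.

(** tr (F /\ F) as the Pfaffian-like pairing of complementary components; both factors
    of the right-hand side come from F = a' ds /\ w + (a^2 - a) w /\ w. *)
Lemma chern_mc :
  let F := curv_mc eps f f' x in
  2 * (qdot (F 0 1) (F 2 3) - qdot (F 0 2) (F 1 3) + qdot (F 0 3) (F 1 2)) =
  eps * (24 * (f + qnormsq x * f') * (f - qnormsq x * f ^+ 2)).
Proof.
rewrite /= qnormsqE /curv_mc /wedge_mc /partial_mc /mc_coords/= !basis_vec_entry/=
  !mkquat_simp.
rewrite /qdot !mkquatE.
by case: heps => ->; ring.
Qed.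

End OnePoint.

End KWEquations.

(** * The Kapustin-Witten equations and the instanton number *)

Section Solution.
Context {R : realType}.
Local Notation V := 'rV[R]_4.
Local Notation T := (measurableTypeR R).
Local Notation mu := (@lebesgue_measure R).
Local Notation mu4 := (((mu \x mu) \x mu) \x mu)%E.
Implicit Types (x y v : V) (eps : R).

Lemma pderiv_real_part eps i j x : eps = 1 \/ eps = - 1 ->
  pderiv i (real_part eps j) x =
    partial_mc eps (real_profile (qnormsq x)) (dreal_profile (qnormsq x)) x i j.
Proof.
move=> heps; rewrite /pderiv; have [_ ->] := is_derive_real_part j x i heps.
by rewrite /partial_mc !mc_form_basis.
Qed.

Lemma pderiv_imag_part eps i j x : eps = 1 \/ eps = - 1 -> qnormsq x != 1 ->
  pderiv i (imag_part eps j) x =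
  partial_mc eps (eps * imag_profile (qnormsq x)) (eps *
    dimag_profile (qnormsq x)) x i j.
Proof.
move=> heps x1; rewrite /pderiv; have [_ ->] := is_derive_imag_part j i heps x1.
by rewrite /partial_mc !mc_form_basis.
Qed.

Lemma two_bits_eq (c d : 'I_4 -> 'I_4 -> V) b0 b1 b2 b3 :
  (forall i j, c i j = d i j) -> two_bits c b0 b1 b2 b3 = two_bits d b0 b1 b2 b3.
Proof. by move=> cd; move: b0 b1 b2 b3 => [] [] [] []; rewrite /= ?cd. Qed.

Lemma curvature_real_part eps b0 b1 b2 b3 x : eps = 1 \/ eps = - 1 ->
  curvature (real_part eps) (bitset b0 b1 b2 b3) x =
  two_bits (curv_mc eps (real_profile (qnormsq x)) (dreal_profile (qnormsq x)) x) b0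
    b1 b2 b3.
Proof.
move=> heps; rewrite curvature_bitset; apply: two_bits_eq => i j.
by rewrite !pderiv_real_part// /real_part !mc_form_basis.
Qed.

Lemma wedge_imag_part eps b0 b1 b2 b3 x : eps = 1 \/ eps = - 1 ->
  wedge (of1 (imag_part eps)) (of1 (imag_part eps)) (bitset b0 b1 b2 b3) x =
  two_bits (wedge_mc eps (eps * imag_profile (qnormsq x)) (eps *
    imag_profile (qnormsq x)) x) b0 b1 b2 b3.
Proof.
move=> heps; rewrite wedge_of1; apply: two_bits_eq => i j.
by rewrite /imag_part !mc_form_basis.
Qed.

Lemma covd_imag_part eps b0 b1 b2 b3 x : eps = 1 \/ eps = - 1 -> qnormsq x != 1 ->
  covd (real_part eps) (of1 (imag_part eps)) (bitset b0 b1 b2 b3) x =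
  two_bits (covd_mc eps (real_profile (qnormsq x)) (eps * imag_profile (qnormsq x))
    (eps * dimag_profile (qnormsq x)) x) b0 b1 b2 b3.
Proof.
move=> heps x1; rewrite covd_of1_bitset; apply: two_bits_eq => i j.
by rewrite !pderiv_imag_part// /imag_part /real_part !mc_form_basis.
Qed.

(** The reason why the coefficients of A and phi commute, so that d_A star phi
    reduces to the ordinary divergence. *)
Lemma qmul_scale_comm (a b : R) (u : V) : qmul (a *: u) (b *: u) =
  qmul (b *: u) (a *: u).
Proof. by apply: quat_eq; rewrite /qmul !mxE/=; ring. Qed.

Lemma kw_solution_real_imag eps : eps = 1 \/ eps = - 1 ->
  kw_solution (~` sphere 1) (real_part eps) (imag_part eps).
Proof.
move=> heps S x /off_sphere x1; split; last first.
  apply: covd_star_of1.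
    by move=> i; have [] := is_derive_imag_part i i heps x1.
  transitivity (\sum_(i < 4) partial_mc eps (eps * imag_profile (qnormsq x)) (eps *
    dimag_profile (qnormsq x)) x i i).
    apply: eq_bigr => i _; rewrite pderiv_imag_part//.
    by rewrite /real_part /imag_part qmul_scale_comm subrr addr0.
  by rewrite big4E/= divergence_mc.
have [b0 [b1 [b2 [b3 ->]]]] := bitsetP S.
rewrite /subform curvature_real_part// wedge_imag_part// star_bitset covd_imag_part//.
have [ode1 ode2] := profile_ode (qnormsq_ge0 x) x1.
have z s i j k l : kw_combination eps
    (kw_ode1 (real_profile (qnormsq x)) (dreal_profile (qnormsq x)) (imag_profile
      (qnormsq x)) (dimag_profile (qnormsq x)))
    (kw_ode2 (qnormsq x) (real_profile (qnormsq x)) (dreal_profile (qnormsq x))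
      (imag_profile (qnormsq x)) (dimag_profile (qnormsq x)))
    x s i j k l = 0.
  by rewrite /kw_combination /kw_ode1 /kw_ode2 ode1 ode2 !scale0r addr0.
rewrite -signr_odd; move: b0 b1 b2 b3 => [] [] [] [];
  rewrite /two_bits/= ?subr0 ?scaler0 ?oppr0 ?addr0 ?expr0 ?expr1//.
- by rewrite kw_defect01.
- by rewrite kw_defect02.
- by rewrite kw_defect03.
- by rewrite kw_defect12.
- by rewrite kw_defect13.
- by rewrite kw_defect23.
Qed.

Lemma sum_bitsets (G : {set 'I_4} -> R) :
  \sum_S G S = \sum_(b0 : bool) \sum_(b1 : bool) \sum_(b2 : bool) \sum_(b3 : bool)
    G (bitset b0 b1 b2 b3).
Proof.
rewrite (reindex (fun b : bool * bool * bool * bool =>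
  bitset b.1.1.1 b.1.1.2 b.1.2 b.2)) /=; last first.
  exists (fun S : {set 'I_4} => (0 \in S, 1 \in S, 2 \in S, 3 \in S)).
    by move=> [[[b0 b1] b2] b3] _ /=; have [-> -> -> ->] := mem_bitset b0 b1 b2 b3.
  move=> S _ /=; have [b0 [b1 [b2 [b3 ->]]]] := bitsetP S.
  by have [-> -> -> ->] := mem_bitset b0 b1 b2 b3.
by rewrite !pair_bigA.
Qed.

Lemma qnormsq_polarization (u v : V) :
  qnormsq (2^-1 *: (u + v)) - qnormsq (2^-1 *: (u - v)) = qdot u v.
Proof. by rewrite !qnormsqE /qdot !mxE; field. Qed.

Lemma qdot0 (u : V) : qdot 0 u = 0.
Proof. by rewrite /qdot !mxE; ring. Qed.

Lemma qdotN (u v : V) : qdot u (- v) = - qdot u v.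
Proof. by rewrite /qdot !mxE; ring. Qed.

Lemma qdotC (u v : V) : qdot u v = qdot v u.
Proof. by rewrite /qdot; ring. Qed.

(** |F^+|^2 - |F^-|^2 is the inner product of F and star F. *)
Lemma normsq_sd_asd (al : Defs.form R) (F : 'I_4 -> 'I_4 -> V) x :
  (forall b0 b1 b2 b3, al (bitset b0 b1 b2 b3) x = two_bits F b0 b1 b2 b3) ->
  form_normsq (sd_part al) x - form_normsq (asd_part al) x =
  2 * (qdot (F 0 1) (F 2 3) - qdot (F 0 2) (F 1 3) + qdot (F 0 3) (F 1 2)).
Proof.
move=> alE; rewrite /form_normsq -sumrB.
transitivity (\sum_S qdot (al S x) (star al S x)).
  by apply: eq_bigr => S _; exact: qnormsq_polarization.
have signE n (u : V) : (-1) ^+ n *: u = if odd n then - u else u.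
  by rewrite -signr_odd; case: odd; rewrite ?expr1 ?scaleN1r ?expr0 ?scale1r.
rewrite sum_bitsets !big_bool/= !star_bitset !alE /two_bits/= !qdot0 ?addr0 ?add0r.
rewrite !signE/= !qdotN (qdotC (F 2 3)) (qdotC (F 1 3)) (qdotC (F 1 2)).
by ring.
Qed.

Lemma trFF_real_part eps x : eps = 1 \/ eps = - 1 ->
  trFF (real_part eps) x = eps * charge_density (qnormsq x).
Proof.
move=> heps; rewrite -(chern_mc _ _ _ heps).
by apply: normsq_sd_asd => b0 b1 b2 b3; exact: curvature_real_part.
Qed.

Lemma measurable_charge_density_norm :
  measurable_fun [set: measurableTypeR R] (fun s : R => charge_density `|s|).
Proof.
apply: continuous_measurable_fun => s.
apply: (@continuous_comp _ _ _ (fun s : R => `|s|) charge_density s).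
  exact: norm_continuous.
by apply: continuous_charge_density; exact: normr_ge0.
Qed.

(** The integral of the density over R^4 is pi^2 times the integral of
    t * charge_density t, that is, 4 pi^2. *)
Lemma instanton_number_real_part eps : eps = 1 \/ eps = - 1 ->
  has_instanton_number (real_part eps) eps.
Proof.
move=> heps; rewrite /has_instanton_number.
(* the absolute value makes the density continuous on the whole line *)
pose h (s : R) := (charge_density `|s|)%:E.
have mh : measurable_fun [set: measurableTypeR R] h.
  by apply/measurable_EFinP; exact: measurable_charge_density_norm.
have h0 s : (0 <= h s)%E by rewrite lee_fin charge_density_ge0.
pose N (p : R * R * R * R) := p.1.1.1 ^+ 2 + p.1.1.2 ^+ 2 + p.1.2 ^+ 2 + p.2 ^+ 2.
have NE p : qnormsq (pt4 p) = N p by rewrite qnormsqE !mkquatE.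
have N0 p : 0 <= N p by rewrite -NE qnormsq_ge0.
have trE p : trFF (real_part eps) (pt4 p) = eps * charge_density `|N p|.
  by rewrite trFF_real_part// NE ger0_norm.
have I : (\int[mu4]_p h (N p) = (4 * pi ^+ 2)%:E)%E.
  rewrite /N (@integral_sqnorm4 _ h)//.
  rewrite (_ : \int[_]_(s in _) _ = 4%:E)%E; first by rewrite -EFinM mulrC.
  rewrite -integral_charge_density; apply: eq_integral => s /[!inE]/=.
  by rewrite in_itv/= andbT => s0; rewrite /h ger0_norm// EFinM.
have mhN : measurable_fun [set: (T * T * T * T)%type] (h \o N).
  by apply: (measurableT_comp mh); exact: measurable_sqnorm4.
have intN : mu4.-integrable setT (h \o N).
  apply/integrableP; split=> //.
  rewrite (_ : (\int[_]_(_ in _) _)%E = (4 * pi ^+ 2)%:E) ?ltry// -I.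
  by apply: eq_integral => p _; rewrite gee0_abs//; exact: h0.
have trFFE : (fun p => (trFF (real_part eps) (pt4 p))%:E) =
  (fun p => eps%:E * (h \o N) p)%E.
  by apply/funext => p; rewrite trE.
split; first by rewrite trFFE; exact: integrableZl.
rewrite /Rintegral trFFE integralZl// I -EFinM/=.
rewrite mulrCA mulVf ?mulr1// mulf_neq0 ?expf_neq0//; apply: lt0r_neq0 => //.
exact: pi_gt0.
Qed.

End Solution.

(** * Regularity of the solution *)

Section RegularityOfSolution.
Context {R : realType}.
Local Notation V := 'rV[R]_4.
Implicit Types (x y v : V) (eps : R) (Om : set V).

Lemma scalarCk_qnormsq k Om : scalarCk k Om (@qnormsq R).
Proof.
rewrite (_ : @qnormsq R = fun x => x 0 0 * x 0 0 + x 0 1 * x 0 1 +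
  x 0 2 * x 0 2 + x 0 3 * x 0 3); last by apply/funext => x; rewrite qnormsqE.
by do 3 (apply: scalarCkD; last by apply: scalarCkM; exact: scalarCk_coord);
  apply: scalarCkM; exact: scalarCk_coord.
Qed.

Lemma continuous_qnormsq : continuous (@qnormsq R).
Proof. by move=> x; apply: (scalarCk_continuous (scalarCk_qnormsq 0 setT)). Qed.

Lemma open_off_sphere : open (~` sphere 1 : set V).
Proof.
rewrite (_ : ~` sphere 1 = @qnormsq R @^-1` [set~ 1]).
  apply: open_comp => [x _|]; first exact: continuous_qnormsq.
  exact: closed_openC.
apply/seteqP; split=> x; first by move/off_sphere => /eqP.
by move=> x1; apply/off_sphere; apply/eqP.
Qed.

(** Off the sphere the cut-off in [excess_sq] is a locally constant factor. *)
Lemma scalarCk_excess_sq_off k : scalarCk k (~` sphere 1) (fun x =>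
  excess_sq (qnormsq x)).
Proof.
pose chi (x : V) : R := if 1 < qnormsq x then 1 else 0.
rewrite (_ : (fun _ => _) = fun x => chi x *
   ((qnormsq x + (-1)) * (qnormsq x + (-1)))); last first.
  apply/funext => x; rewrite /chi /excess_sq; case: ltP => x1.
    by rewrite mul1r -expr2 max_l// subr_ge0 ltW.
  by rewrite mul0r max_r ?expr0n// subr_le0.
have CN1 : scalarCk k (~` sphere 1 : set V) (fun x => qnormsq x + (-1)).
  by apply: scalarCkD; [exact: scalarCk_qnormsq|exact: scalarCk_cst].
apply: scalarCkM; last exact: scalarCkM.
apply: scalarCk_locally_constant => x /off_sphere; rewrite neq_lt => /orP[x1|x1].
  have : \forall y \near x, qnormsq y < 1 by
    exact: (@cvgr_lt _ _ _ (nbhs_filter x) _ _ (@continuous_qnormsq x) _ x1).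
  by apply: filterS => y y1; rewrite /chi !ltNge !ltW.

have : \forall y \near x, 1 < qnormsq y by
  exact: (@cvgr_gt _ _ _ (nbhs_filter x) _ _ (@continuous_qnormsq x) _ x1).
by apply: filterS => y y1; rewrite /chi y1 x1.
Qed.

Lemma scalarC1_excess_sq Om : scalarCk 1 Om (fun x => excess_sq (qnormsq x)).
Proof.
split.
  move=> x _; apply: (@continuous_comp _ _ _ (@qnormsq R) excess_sq x).
    exact: continuous_qnormsq.
  exact: continuous_excess_sq.
move=> i; exists (fun x => dexcess_sq (qnormsq x) * (2 * x 0 i)); split.
  by move=> x _; apply: is_derive_radial; exact: is_derive_excess_sq.
split=> // x _; apply: (@continuousM _ _ (fun x =>
  dexcess_sq (qnormsq x)) (fun x : V => 2 * x 0 i)).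
  apply: (@continuous_comp _ _ _ (@qnormsq R) dexcess_sq x).
    exact: continuous_qnormsq.
  exact: continuous_dexcess_sq.
apply: (@continuousM _ _ (cst 2) (fun x : V => x 0 i)); first exact: cst_continuous.
exact: coord_continuous.
Qed.

Lemma scalarCk_quadr k Om : scalarCk k Om (fun x => quadr (qnormsq x)).
Proof.
have CN := scalarCk_qnormsq k Om.
rewrite /quadr; under eq_fun do rewrite expr2.
apply: scalarCkD; last exact: scalarCk_cst.
by apply: scalarCkD; apply: scalarCkM => //; exact: scalarCk_cst.
Qed.

Lemma scalarCk_real_profile k Om : scalarCk k Om (fun x => excess_sq (qnormsq x)) ->
  scalarCk k Om (fun x => real_profile (qnormsq x)).
Proof.
move=> Cp; have CN := scalarCk_qnormsq k Om.
have Cq := scalarCk_quadr k Om.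
have Cd : scalarCk k Om (fun x => paste_den (qnormsq x)).
  rewrite (_ : (fun _ => _) = fun x : V => qnormsq x * qnormsq x + (-1) * qnormsq x
     + 1 + (-1) * excess_sq (qnormsq x)).
    have CC (c : R) (f : V -> R) : scalarCk k Om f -> scalarCk k Om (fun x => c * f x).
      by apply: scalarCkM; exact: scalarCk_cst.
    apply: scalarCkD; last exact: CC.
    apply: scalarCkD; last exact: scalarCk_cst.
    by apply: scalarCkD; [exact: scalarCkM|exact: CC].
  by apply/funext => x; rewrite /paste_den; ring.
have N0 := @qnormsq_ge0 R.
apply: scalarCkM; last by apply: scalarCkV => // x _; exact/lt0r_neq0/quadr_gt0.
apply: scalarCkD; first exact: scalarCk_cst.
by apply: scalarCkM => //; apply: scalarCkV => // x _; exact/lt0r_neq0/paste_den_gt0.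
Qed.

Lemma scalarCk_imag_profile k : scalarCk k (~` sphere 1) (fun x =>
  imag_profile (qnormsq x)).
Proof.
have CN := scalarCk_qnormsq k (~` sphere 1).
have N0 := @qnormsq_ge0 R.
rewrite (_ : (fun _ => _) = fun x : V => (-3) * (qnormsq x + 1) *
   ((qnormsq x + (-1)) * quadr (qnormsq x))^-1); last first.
  by apply/funext => x; rewrite /imag_profile; congr (_ * _); ring.
apply: scalarCkM.
  apply: scalarCkM; first exact: scalarCk_cst.
  by apply: scalarCkD => //; exact: scalarCk_cst.
apply: scalarCkV.
  move=> x /off_sphere x1; rewrite mulf_neq0 ?subr_eq0//.
  exact/lt0r_neq0/quadr_gt0.
apply: scalarCkM; last exact: scalarCk_quadr.
by apply: scalarCkD => //; exact: scalarCk_cst.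
Qed.

Lemma scalarCk_mc_coords k Om eps i j : scalarCk k Om (fun x => mc_coords eps i x 0 j).
Proof.
have Cc c l : scalarCk k Om (fun x => c * x 0 l).
  by apply: scalarCkM; [exact: scalarCk_cst|exact: scalarCk_coord].
have CN (f : V -> R) : scalarCk k Om f -> scalarCk k Om (fun x => - f x).
  move=> Cf; rewrite (_ : (fun _ => _) = fun x => (-1) * f x).
    by apply: scalarCkM => //; exact: scalarCk_cst.
  by apply/funext => x; rewrite mulN1r.
have E (f0 f1 f2 f3 : V -> R) : scalarCk k Om f0 -> scalarCk k Om f1 ->
    scalarCk k Om f2 -> scalarCk k Om f3 ->
    scalarCk k Om (fun x => mkquat (f0 x) (f1 x) (f2 x) (f3 x) 0 j).
  move=> C0 C1 C2 C3; under eq_fun do rewrite mxE.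
  by case: j => [[|[|[|[|//]]]] lt4].
case: i => [[|[|[|[|//]]]] lt4]; apply: E; rewrite /mc_coords /=;
  by first [exact: scalarCk_cst|exact: Cc|exact: scalarCk_coord|
            apply: CN; exact: Cc|apply: CN; exact: scalarCk_coord].
Qed.

Lemma Ck_radial_form k Om eps (f : V -> R) i : open Om ->
  eps = 1 \/ eps = - 1 -> scalarCk k Om f ->
  Ck k Om (fun x => f x *: mc_form eps (basis_vec i) x).
Proof.
move=> oOm heps Cf.
apply: (Ck_of_coords (f := fun j x => f x * mc_coords eps i x 0 j)) => // [j x _|j].
  by rewrite mxE mc_form_basis.
by apply: scalarCkM => //; exact: scalarCk_mc_coords.
Qed.

Lemma smooth_real_part eps i : eps = 1 \/ eps = - 1 ->
  smooth (~` sphere 1) (real_part eps i).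
Proof.
move=> heps k; apply: Ck_radial_form => //; first exact: open_off_sphere.
by apply: scalarCk_real_profile; exact: scalarCk_excess_sq_off.
Qed.

Lemma C1_real_part eps i : eps = 1 \/ eps = - 1 -> Ck 1 setT (real_part eps i).
Proof.
move=> heps; apply: Ck_radial_form => //; first exact: openT.
by apply: scalarCk_real_profile; exact: scalarC1_excess_sq.
Qed.

Lemma smooth_imag_part eps i : eps = 1 \/ eps = - 1 ->
  smooth (~` sphere 1) (imag_part eps i).
Proof.
move=> heps k.
apply: (@Ck_radial_form _ _ _ (fun x => eps * imag_profile (qnormsq x))) => //.
  exact: open_off_sphere.
by apply: scalarCkM; [exact: scalarCk_cst|exact: scalarCk_imag_profile].
Qed.

End RegularityOfSolution.

(** * Rotational invariance *)

Section RotationalInvariance.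
Context {R : realType}.
Local Notation V := 'rV[R]_4.
Implicit Types (a b x y v w : V) (eps : R).

Lemma quatE x : x = mkquat (x 0 0) (x 0 1) (x 0 2) (x 0 3).
Proof. by apply: quat_eq; rewrite mxE. Qed.

Lemma qconj_mkquat (p q r s : R) : qconj (mkquat p q r s) = mkquat p (- q) (- r) (- s).
Proof. by rewrite /qconj !mkquatE. Qed.

Lemma qmulZl (k : R) x y : qmul (k *: x) y = k *: qmul x y.
Proof. by apply: quat_eq; rewrite /qmul !mxE/=; ring. Qed.

Lemma qmulZr (k : R) x y : qmul x (k *: y) = k *: qmul x y.
Proof. by apply: quat_eq; rewrite /qmul !mxE/=; ring. Qed.

Lemma qmulA x y v : qmul x (qmul y v) = qmul (qmul x y) v.
Proof.
rewrite (quatE x) (quatE y) (quatE v) !qmul_mkquat.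
by congr (mkquat _ _ _ _); ring.
Qed.

Lemma qconjM x y : qconj (qmul x y) = qmul (qconj y) (qconj x).
Proof.
rewrite (quatE x) (quatE y) !(qmul_mkquat, qconj_mkquat).
by congr (mkquat _ _ _ _); ring.
Qed.

Lemma qconjK : involutive (@qconj R).
Proof. by move=> x; rewrite (quatE x) !qconj_mkquat !opprK. Qed.

Lemma qmul_conj x : qmul x (qconj x) = mkquat (qnormsq x) 0 0 0.
Proof.
rewrite qnormsqE {1 2}(quatE x) qconj_mkquat qmul_mkquat.
by congr (mkquat _ _ _ _); ring.
Qed.

Lemma qmul1 x : qmul x (mkquat 1 0 0 0) = x.
Proof. by rewrite (quatE x) qmul_mkquat; congr (mkquat _ _ _ _); ring. Qed.

Lemma qnormsq_conj x : qnormsq (qconj x) = qnormsq x.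
Proof. by rewrite !qnormsqE /qconj !mkquatE !sqrrN. Qed.

Lemma qnormsqM x y : qnormsq (qmul x y) = qnormsq x * qnormsq y.
Proof. by rewrite (quatE x) (quatE y) qmul_mkquat !qnormsqE !mkquatE; ring. Qed.

Lemma qunitE x : qunit x <-> qnormsq x = 1.
Proof.
rewrite /qunit /qnorm; split=> [|->]; last by rewrite sqrtr1.
by move=> /(congr1 (fun u => u ^+ 2)); rewrite sqr_sqrtr ?qnormsq_ge0// expr1n.
Qed.

(** The real part of x is central, so it contributes a real number to a x abar. *)
Lemma qim_conjugate a x : qim (qmul (qmul a x) (qconj a)) =
  qmul (qmul a (qim x)) (qconj a).
Proof.
rewrite /qim (quatE a) (quatE x) !(qmul_mkquat, qconj_mkquat, mkquatE).
by congr (mkquat _ _ _ _); ring.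
Qed.

Lemma twist1 x : twist 1 x = x.
Proof. by rewrite /twist !mul1r -quatE. Qed.

Lemma twistN1 x : twist (- 1) x = qconj x.
Proof. by rewrite /twist /qconj !mulN1r. Qed.

(** For eps = 1, (a x b) conj (a v b) = a (x vbar) abar since b bbar = 1; for
    eps = - 1 the roles of a and b are exchanged by conjugation. *)
Lemma mc_form_rotate eps a b : eps = 1 \/ eps = - 1 -> qunit a -> qunit b ->
  exists2 u, qunit u & forall v x,
    mc_form eps (qmul (qmul a v) b) (qmul (qmul a x) b) =
    qmul (qmul u (mc_form eps v x)) (qconj u).
Proof.
move=> heps /qunitE a1 /qunitE b1.
have bb : qmul b (qconj b) = mkquat 1 0 0 0 by rewrite qmul_conj b1.
have aa : qmul (qconj a) a = mkquat 1 0 0 0.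
  by rewrite -{2}(qconjK a) qmul_conj qnormsq_conj a1.
case: heps => ->.
  exists a; first exact/qunitE.
  move=> v x; rewrite /mc_form !twist1 -qim_conjugate; congr (qim _).
  by rewrite !qconjM !qmulA -(qmulA _ b) bb qmul1.
exists (qconj b); first by apply/qunitE; rewrite qnormsq_conj.
move=> v x; rewrite /mc_form !twistN1 -qim_conjugate; congr (qim _).
by rewrite !qconjM !qconjK !qmulA -(qmulA _ (qconj a)) aa qmul1.
Qed.

Lemma sum_mc_form_basis eps y (c : 'I_4 -> R) v : eps = 1 \/ eps = - 1 ->
  (forall j, c j = v 0 j) ->
  \sum_(j < 4) c j *: mc_form eps (basis_vec j) y = mc_form eps v y.
Proof.
move=> heps cv; rewrite big4E/= !cv !mc_form_basis// /mc_coords/= mcformE//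
  !mkquat_simp.
by congr (mkquat _ _ _ _); ring.
Qed.

Lemma pderiv_rotation i a b y : pderiv i (fun y => qmul (qmul a y) b) y =
  qmul (qmul a (basis_vec i)) b.
Proof.
have lin (h : R) : qmul (qmul a (h *: basis_vec i + y)) b =
    h *: qmul (qmul a (basis_vec i)) b + qmul (qmul a y) b.
  by rewrite qmulDr qmulDl qmulZr qmulZl.
by have [_] := @is_derive_linear _ (fun y => qmul (qmul a y) b) y (basis_vec i) lin.
Qed.

(** The gauge transformation is constant, so that its derivative does not contribute. *)
Lemma rot_invariant_radial eps Om (f g : R -> R) : eps = 1 \/ eps = - 1 ->
  rot_invariant Om (fun i x => f (qnormsq x) *: mc_form eps (basis_vec i) x)
    (fun i x => g (qnormsq x) *: mc_form eps (basis_vec i) x).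
Proof.
move=> heps a b a1 b1; have [u u1 uE] := mc_form_rotate heps a1 b1.
have pull (h : R -> R) i x :
    pullback1 (fun y => qmul (qmul a y) b)
      (fun i x => h (qnormsq x) *: mc_form eps (basis_vec i) x) i x =
    qmul (qmul u (h (qnormsq x) *: mc_form eps (basis_vec i) x)) (qconj u).
  rewrite /pullback1 !qnormsqM (iffLR (qunitE a) a1) (iffLR (qunitE b) b1) mul1r mulr1.
  under eq_bigr do rewrite scalerA mulrC -scalerA.
  rewrite -scaler_sumr (@sum_mc_form_basis eps _ _ (qmul (qmul a (basis_vec i)) b))//.
    by rewrite uE qmulZr qmulZl.
  by move=> j; rewrite pderiv_rotation.
exists (fun=> u); split=> // [k|i x _].
  apply: (Ck_of_coords (f := fun j _ => u 0 j)) => //; first exact: openT.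
  by move=> j; exact: scalarCk_cst.
rewrite !pull; split=> //.
rewrite /gauge_conn (_ : pderiv i (fun=> u) x = 0); last exact: derive_cst.
by rewrite qmul0l subr0.
Qed.

End RotationalInvariance.

(** * Singularity of the imaginary part and conclusion *)

Section Singularity.
Context {R : realType}.
Local Notation V := 'rV[R]_4.
Implicit Types (eps : R).

(** Along the axis x = s I the form phi_0 is imag_profile (s^2) s I.  Clearing the
    denominator of a continuous extension gives a continuous function of s that
    vanishes for s > 1 and takes the value 6 at s = 1. *)
Lemma imag_part_singular eps : eps = 1 \/ eps = - 1 ->
  ~ extends_continuously (~` sphere 1) (imag_part eps).
Proof.
move=> heps [psi [cpsi psiE]].
pose p (s : R) : V := mkquat 0 s 0 0.
have pN s : qnormsq (p s) = s ^+ 2 by rewrite qnormsqE !mkquatE; ring.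
have cp : continuous p.
  move=> s; apply: continuous_row => j.
  rewrite (_ : (fun _ => _) = fun s => s * p 1 0 j); last first.
    apply/funext => u; rewrite !mxE.
    by case: j => [[|[|[|[|//]]]] lt4]; rewrite /= ?mulr0 ?mulr1.
  by apply: continuousM; [exact: cvg_id|exact: cst_continuous].
pose h (s : R) := psi 0 (p s) 0 1 * ((s ^+ 2 - 1) * (s ^+ 4 + 4 * s ^+ 2 + 1)) +
  3 * (s ^+ 2 + 1) * s.
have h0 s : 1 < s -> h s = 0.
  move=> s1; have s2 : s ^+ 2 - 1 != 0 by apply: lt0r_neq0; nra.
  have q0 := lt0r_neq0 (quadr_gt0 (sqr_ge0 s)).
  have -> : h s = imag_profile (s ^+ 2) * s * ((s ^+ 2 - 1) * quadr (s ^+ 2)) + 3 *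
    (s ^+ 2 + 1) * s.
    rewrite /h (_ : s ^+ 4 + 4 * s ^+ 2 + 1 = quadr (s ^+ 2)); last by rewrite /quadr;
      ring.
    rewrite psiE; last by apply/off_sphere; rewrite pN -subr_eq0.
    rewrite /imag_part pN mc_form_basis// /mc_coords /= mkquatZ !mkquatE.
    by case: heps => ->; ring.
  by rewrite /imag_profile; field; rewrite s2 q0.
have ch : h s @[s --> (1 : R)] --> h 1.
  have cX (n : nat) : (fun s : R => s ^+ n) s @[s --> (1 : R)] --> (1 ^+ n : R).
    exact: exprn_continuous.
  have cpsi1 : psi 0 (p s) 0 1 @[s --> (1 : R)] --> psi 0 (p 1) 0 1.
    apply: (@continuous_comp _ _ _ p (fun x => psi 0 x 0 1) 1); first exact: cp.
    apply: (@continuous_comp _ _ _ (psi 0) (fun y : V => y 0 1)); first exact: cpsi.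
    exact: coord_continuous.
  apply: cvgD.
    apply: cvgM => //; apply: cvgM; first by apply: cvgB; [exact: cX|exact: cvg_cst].
    apply: cvgD; last exact: cvg_cst.
    by apply: cvgD; [exact: cX|apply: cvgM; [exact: cvg_cst|exact: cX]].
  apply: cvgM; last exact: cvg_id.
  apply: cvgM; first exact: cvg_cst.
  by apply: cvgD; [exact: cX|exact: cvg_cst].
have h1 : 0 < h 1 by rewrite /h expr1n subrr; lra.
have hpos : \forall s \near 1^'+, 0 < h s.
  by apply: (@cvgr_gt _ _ _ _ h (h 1)) => //; exact: cvg_at_right_filter.
have hzero : \forall s \near 1^'+, h s = 0.
  by near=> s; apply: h0; near: s; exact: nbhs_right_gt.
near (1 : R)^'+ => s.
have : 0 < h s by near: s.
by rewrite (_ : h s = 0) ?ltxx//; near: s.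
Unshelve. all: by end_near. Qed.

End Singularity.

Theorem theorem1p2 (R : realType) (eps : R) (heps : eps = 1 \/ eps = - 1) :
  exists Fam : set (oneform R * oneform R),
    Fam !=set0 /\
    forall (A phi : oneform R), Fam (A, phi) ->
    exists r : R, 0 < r /\
      let off := ~` sphere r in
      su2_valued setT A /\ su2_valued off phi /\
      kw_solution off A phi /\
      rot_invariant off A phi /\
      has_instanton_number A eps /\
      (forall i : 'I_4, smooth off (A i) /\ smooth off (phi i)) /\
      (forall i : 'I_4, Ck 1 setT (A i)) /\
      ~ extends_continuously off phi.
Proof.
exists [set (real_part eps, imag_part eps)]; split.
  by exists (real_part eps, imag_part eps).
move=> A phi [-> ->]; exists 1; split; first exact: ltr01.
have su2 (c : R) (i : 'I_4) x : qimag (c *: mc_form eps (basis_vec i) x).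
  by rewrite /qimag mxE /mc_form /qim mkquat0 mulr0.
split; first by move=> i x _; exact: su2.
split; first by move=> i x _; exact: su2.
split; first exact: kw_solution_real_imag.
split; first
  exact: (@rot_invariant_radial R eps _ real_profile (fun t => eps * imag_profile t)).
split; first exact: instanton_number_real_part.
split; first by move=> i; split; [exact: smooth_real_part|exact: smooth_imag_part].
by split; [move=> i; exact: C1_real_part|exact: imag_part_singular].
Qed.
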